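(* Let $d\ge2$ and $p_1,\dots,p_d\in(0,1)$, and consider the random simplicial complex $\mathbf X(n,\mathbf p)$ with $\mathbf p=(p_1,\dots,p_{n-1})$ and $p_i=0$ for $i>d$. Put $p^*=\min\{p_j: j\in[d]\}$ and suppose $n$ is such that $$d\le\log_2\ln n+\log_2\log_2\ln n-\log_2(-\ln p^* ).$$ Let $2\le i\le d$ be an integer, $P_i=\prod_{j=1}^{i-1}p_j^{\binom{i+1}{j+1}}$, $W_i=\sqrt{\binom{n}{i+1}P_i}\,(\hat p_i-p_i)$ and $Z_i\sim\mathcal N(0,p_i(1-p_i))$, where $\hat p_i$ is the maximum likelihood estimator of $p_i$. Then $$d_{\mathrm{KS}}(W_i,Z_i)\le\frac{\sqrt{10}+3}{3\sqrt\pi}\,\big(p_i(1-p_i)P_i\big)^{-\frac12}\binom{n}{i+1}^{-\frac12}+2(n-i)^{-2}P_i^{-1}(i+1)^{\frac{i+6}{2}}\Big(\ln\binom{n}{i+1}\Big)^{\frac12}+2\binom{n}{i+1}^{-2}.$$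
   Context: $[n]=\{1,\dots,n\}$. Given $\mathbf p=(p_1,\dots,p_{n-1})\in[0,1]^{n-1}$, let $H$ be the random hypergraph on $[n]$ in which every singleton is present and every subset of $[n]$ of size $k+1\ge2$ is included with probability $p_k$, independently of all other subsets. $\mathbf X(n,\mathbf p)$ is the largest simplicial complex contained in $H$: a nonempty $s\subseteq[n]$ is a simplex iff every nonempty $t\subseteq s$ lies in $H$. A simplex with $i+1$ vertices is an $i$-simplex. A set $s\subseteq[n]$ with $|s|=i+1$ spans a hollow $i$-simplex if all nonempty proper subsets of $s$ are simplices (whether or not $s$ itself is). Let $S_i$ be the number of $i$-simplices and $H_i$ the number of sets spanning hollow $i$-simplices in $\mathbf X(n,\mathbf p)$. The MLE (with the paper's convention when it is not unique) is $\hat p_i=S_i/H_i$ if $H_i\ne0$ and $\hat p_i=0$ if $H_i=0$. For real random variables $X,Y$, $d_{\mathrm{KS}}(X,Y)=\sup_{x\in\mathbb R}|\mathbb P(X\le x)-\mathbb P(Y\le x)|$. *)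

(* Defs.v *)
From HB Require Import structures.
From mathcomp Require Import all_boot all_order all_algebra.
From mathcomp Require Import all_classical all_reals all_analysis.

Set Implicit Arguments.
Unset Strict Implicit.
Unset Printing Implicit Defensive.

Import Order.TTheory GRing.Theory Num.Theory.

Local Open Scope ring_scope.

Section log2.
Context {R : realType}.

(* [ln] is 0 outside ]0, +oo[, so log2 x is meaningful only for 0 < x. *)
Definition log2 (x : R) : R := ln x / ln 2.

End log2.

Section independence.
Context {d : measure_display} {T : measurableType d} {R : realType}.

Definition mutually_independent (P : probability T R) (I : finType)
    (D : {set I}) (A : I -> set T) :=
  forall J : {set I}, J \subset D ->
    P (\bigcap_(s in [set` J]) A s)%classic = (\prod_(s in J) P (A s))%E.

End independence.

(* The vertex set {1, ..., n} is represented by 'I_n. Whether set0 belongs to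
   a hypergraph is irrelevant: all notions below only inspect nonempty sets. *)
Definition hypergraph (n : nat) : Type := {set {set 'I_n}}.

HB.instance Definition _ (n : nat) := Finite.on (hypergraph n).
HB.instance Definition _ (n : nat) := isPointed.Build (hypergraph n) finset.set0.
HB.instance Definition _ (n : nat) := @isMeasurable.Build default_measure_display
  (hypergraph n) discrete_measurable discrete_measurable0
  discrete_measurableC discrete_measurableU.

Section complex.
Context {n : nat}.
Implicit Types (H : hypergraph n) (s t : {set 'I_n}).

(* The largest simplicial complex contained in H. *)
Definition simplices H : {set {set 'I_n}} :=
  [set s | (s != finset.set0) &&
    [forall t : {set 'I_n}, (t != finset.set0) && (t \subset s) ==> (t \in H)]]%SET.

Definition faces H (i : nat) : {set {set 'I_n}} :=
  [set s in simplices H | #|s| == i.+1]%SET.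

Definition hollow_faces H (i : nat) : {set {set 'I_n}} :=
  [set s : {set 'I_n} | (#|s| == i.+1) &&
    [forall t : {set 'I_n},
       (t != finset.set0) && (t \proper s) ==> (t \in simplices H)]]%SET.

End complex.

Section random_complex.
Context {R : realType} {n : nat}.

(* p j is the inclusion probability of a set of j.+1 vertices; the value p 0
   plays no role. *)
Definition random_hypergraph {d : measure_display} {T : measurableType d}
    (P : probability T R) (p : nat -> R) (H : {RV P >-> hypergraph n}) :=
  [/\ forall (w : T) (v : 'I_n), [set v]%SET \in (H w : {set {set 'I_n}}),
      forall (k : nat) (s : {set 'I_n}), (1 <= k)%N -> #|s| = k.+1 ->
        P [set w | s \in (H w : {set {set 'I_n}})]%classic = (p k)%:E
    & mutually_independent P [set s : {set 'I_n} | (2 <= #|s|)%N]%SET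
        (fun s => [set w | s \in (H w : {set {set 'I_n}})]%classic)].

Definition mle (i : nat) (H : hypergraph n) : R :=
  if #|hollow_faces H i| == 0%N then 0
  else #|faces H i|%:R / #|hollow_faces H i|%:R.

(* The probability that a given set of i.+1 vertices spans a hollow
   i-simplex. *)
Definition hollow_prob (p : nat -> R) (i : nat) : R :=
  \prod_(1 <= j < i) p j ^+ 'C(i.+1, j.+1).

Definition normalized_mle (p : nat -> R) (i : nat) (H : hypergraph n) : R :=
  Num.sqrt ('C(n, i.+1)%:R * hollow_prob p i) * (mle i H - p i).

Lemma measurable_normalized_mle (p : nat -> R) (i : nat) :
  measurable_fun [set: hypergraph n]%classic (normalized_mle p i).
Proof. by move=> _ Y _. Qed.

HB.instance Definition _ (p : nat -> R) (i : nat) :=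
  isMeasurableFun.Build _ _ _ _ (normalized_mle p i)
    (measurable_normalized_mle p i).

(* The minimum over 1 <= j <= d; the default p 1 is itself in this range when
   1 <= d. *)
Definition min_prob (p : nat -> R) (d : nat) : R :=
  \big[Order.min/p 1%N]_(1 <= j < d.+1) p j.

End random_complex.

Arguments random_hypergraph {R n d T} P p H.

Section normal_law.
Context {d : measure_display} {T : measurableType d} {R : realType}.
Variable P : probability T R.

(* [normal_prob] is parameterized by the standard deviation. *)
Definition normal_law (X : {RV P >-> R}) (m variance : R) :=
  forall A : set R, measurable A ->
    distribution P X A = normal_prob m (Num.sqrt variance) A.

End normal_law.

Arguments normal_law {d T R} P X m variance.

Section Kolmogorov_Smirnov.
Context {d d' : measure_display} {T : measurableType d} {T' : measurableType d'}.
Context {R : realType}.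
Variables (P : probability T R) (Q : probability T' R).

Definition KS_distance (X : {RV P >-> R}) (Y : {RV Q >-> R}) : \bar R :=
  ereal_sup (range (fun x : R => `|cdf X x - cdf Y x|%E)).

End Kolmogorov_Smirnov.

Arguments KS_distance {d d' T T' R} P Q X Y.

(* Main.v *)
Require Import Defs.
From mathcomp Require Import all_boot all_order all_algebra.
From mathcomp Require Import all_classical all_reals all_analysis.
From mathcomp Require Import ring lra.

(* Given the faces of dimension less than i, the number of i-simplices is
   binomial with parameters the number N of hollow i-simplices and p_i.

   - Stein's method gives a Berry-Esseen bound for the binomial law. If f solves
     the Stein equation at a lattice point and B' has one trial less than B,
     then E[(B - mp) f(B)] = mpq E[f(B' + 1) - f(B')]. Over one lattice step,
     replacing the increment of f by an endpoint average of w f(w) costs at most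
     half a step times sup (w f(w))', and this derivative lies between 0 and
     sqrt(pi/2)/2 + 1/2 + |w|. The resulting constant is below
     (sqrt 10 + 3) / (3 sqrt pi).

   - With X = N / E N, the bound on the conditional law of W_i is
     b / sqrt X for the distance to Phi(y sqrt X). Both b / sqrt X and
     Phi(y sqrt X) are quadratic in X - 1 up to O((X - 1)^2), and the linear
     terms average out, so only the variance of X enters. That is why the
     second error term is of order n^-2 and not n^-1.

   - The variance of X is bounded by the proportion of pairs of (i+1)-sets that
     share at least two vertices, divided by P_i. *)

Set Implicit Arguments.
Unset Strict Implicit.
Unset Printing Implicit Defensive.

Import Order.TTheory GRing.Theory Num.Theory.
Import numFieldNormedType.Exports.

Local Open Scope ring_scope.

(** * Numerical bound on pi *)

(** Most calculus inequalities below come from this: the difference of the two sides has a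
    derivative of constant sign and a known value at one end. *)
Lemma is_derive_ge0_le {R : realType} (f df : R -> R) (a b : R) : a <= b ->
  (forall x, a <= x <= b -> is_derive x 1 f (df x)) ->
  (forall x, a <= x <= b -> 0 <= df x) -> f a <= f b.
Proof.
move=> ab fdf df_ge0.
have [||c cab fE] := @MVT_segment R f df a b ab.
- by move=> x; rewrite in_itv/= => /andP[/ltW ? /ltW ?]; apply: fdf; apply/andP.
- apply: derivable_within_continuous => x; rewrite in_itv/= => xab.
  by have [] := fdf x xab.
by rewrite -subr_ge0 fE mulr_ge0 ?subr_ge0// df_ge0//; move: cab; rewrite in_itv.
Qed.

Section pi_bound.
Context {R : realType}.
Implicit Type x : R.

(** Up to [cos_le_taylor4], each Taylor bound is the sign of the derivative needed for the next one;
    the chain starts from cos y <= 1. *)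
Let sin_le x : 0 <= x -> sin x <= x.
Proof.
move=> x0; rewrite -subr_ge0.
have -> : 0 = 0 - sin 0 :> R by rewrite sin0 subr0.
apply: (@is_derive_ge0_le R (fun y => y - sin y) (fun y => 1 - cos y)) => // y _;
  rewrite subr_ge0 cos_le1.
Qed.

Let cos_ge x : 0 <= x -> 1 - x ^+ 2 / 2 <= cos x.
Proof.
move=> x0; rewrite -subr_ge0.
have -> : 0 = cos 0 - (1 - 0 ^+ 2 / 2) :> R by rewrite cos0; ring.
apply: (@is_derive_ge0_le R (fun y => cos y - (1 - y ^+ 2 / 2))
  (fun y => y - sin y)) => //.
  by move=> y _; apply: is_derive_eq; rewrite /GRing.scale/=; field.
by move=> y /andP[y0 _]; rewrite subr_ge0 sin_le.
Qed.

Let sin_ge x : 0 <= x -> x - x ^+ 3 / 6 <= sin x.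
Proof.
move=> x0; rewrite -subr_ge0.
have -> : 0 = sin 0 - (0 - 0 ^+ 3 / 6) :> R by rewrite sin0; ring.
apply: (@is_derive_ge0_le R (fun y => sin y - (y - y ^+ 3 / 6))
  (fun y => cos y - (1 - y ^+ 2 / 2))) => //.
  by move=> y _; apply: is_derive_eq; rewrite /GRing.scale/=; field.
by move=> y /andP[y0 _]; rewrite subr_ge0 cos_ge.
Qed.

Lemma cos_le_taylor4 x : 0 <= x -> cos x <= 1 - x ^+ 2 / 2 + x ^+ 4 / 24.
Proof.
move=> x0; rewrite -subr_ge0.
have -> : 0 = (1 - 0 ^+ 2 / 2 + 0 ^+ 4 / 24) - cos 0 :> R by rewrite cos0; ring.
apply: (@is_derive_ge0_le R (fun y => 1 - y ^+ 2 / 2 + y ^+ 4 / 24 - cos y)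
  (fun y => sin y - (y - y ^+ 3 / 6))) => //.
  by move=> y _; apply: is_derive_eq; rewrite /GRing.scale/=; field.
by move=> y /andP[y0 _]; rewrite subr_ge0 sin_ge.
Qed.

(** At x = pi / 2 the quartic bound reads 0 <= 1 - y / 2 + y^2 / 24 with y = x^2. As y < 4 excludes
    the range beyond the larger root, y is at most the smaller root 6 - 2 sqrt 3, which is below (33
    / 20)^2. *)
Lemma pi_le_33_10 : pi <= 33 / 10 :> R.
Proof.
have := @cos_le_taylor4 (pi / 2).
have := @pihalf_lt2 R; have := @pihalf_ge1 R; rewrite cos_pihalf.
set x := pi / 2 => x1 x2 /(_ (le_trans ler01 x1)) h.
have -> : pi = 2 * x by rewrite /x mulrC divfK.
have y4 : x ^+ 2 < 4 by nra.
have : x ^+ 2 <= (165 / 100) ^+ 2.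
  move: h; have -> : x ^+ 4 = x ^+ 2 * x ^+ 2 by ring.
  by move: y4; set y := x ^+ 2 => y4 h; nra.
by rewrite ler_sqr ?nnegrE; lra.
Qed.

End pi_bound.

(** * The Gaussian density and its distribution function *)

Section gauss_density.
Context {R : realType}.
Local Open Scope classical_set_scope.
Local Open Scope ring_scope.
Implicit Types x y : R.

Definition gauss_density x : R := (Num.sqrt (2 * pi))^-1 * expR (- (x ^+ 2 / 2)).

Lemma gauss_density_gt0 x : 0 < gauss_density x.
Proof. by rewrite mulr_gt0 ?expR_gt0// invr_gt0 sqrtr_gt0 mulr_gt0// pi_gt0. Qed.

Lemma gauss_densityN x : gauss_density (- x) = gauss_density x.
Proof. by rewrite /gauss_density sqrrN. Qed.

Lemma gauss_density0 : gauss_density 0 = (Num.sqrt (2 * pi))^-1.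
Proof. by rewrite /gauss_density expr0n/= mul0r oppr0 expR0 mulr1. Qed.

Lemma is_derive_gauss_density x :
  is_derive x 1 gauss_density (- (x * gauss_density x)).
Proof.
have h : is_derive x 1 (fun y : R => expR (- (y ^+ 2 / 2)))
    (expR (- (x ^+ 2 / 2)) * (- x)).
  apply: (@is_derive1_comp R expR (fun y => - (y ^+ 2 / 2))).
  by apply: is_derive_eq; rewrite /GRing.scale/=; field.
by apply: is_derive_eq; rewrite /gauss_density /GRing.scale/=; ring.
Qed.

(** This is e^u >= 1 + u at u = x^2 / 2. It yields the maximum of the density, its decay at infinity
    and the bound on u phi(u). *)
Lemma gauss_density_le x : (1 + x ^+ 2 / 2) * gauss_density x <= gauss_density 0.
Proof.
rewrite gauss_density0 mulrC -mulrA ler_piMr ?invr_ge0// expRN.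
by rewrite ler_pdivrMl ?expR_gt0// mulr1 expR_ge1Dx.
Qed.

Lemma gauss_density_max x : gauss_density x <= gauss_density 0.
Proof.
apply: le_trans (gauss_density_le x); rewrite ler_peMl ?(ltW (gauss_density_gt0 x))//.
by nra.
Qed.

Lemma gauss_density_cvgy0 : gauss_density x @[x --> +oo] --> (0 : R).
Proof.
apply/cvgrPdist_le => e e0; near=> x.
rewrite sub0r normrN ger0_norm ?(ltW (gauss_density_gt0 x))//.
have x0 : 0 < x by near: x; apply: nbhs_pinfty_gt; exact: num_real.
have xe : gauss_density 0 / e + 1 < x by near: x; apply: nbhs_pinfty_gt;
  exact: num_real.
have h := gauss_density_le x.
have c0 := gauss_density_gt0 0; have cx := gauss_density_gt0 x.
have : x * gauss_density x <= gauss_density 0.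
  by apply: le_trans h; rewrite ler_pM2r//; have := sqr_ge0 (x - 1); nra.
move=> {}h; have : gauss_density 0 / e <= x by lra.
rewrite ler_pdivrMr// => h2.
by rewrite -(ler_pM2l x0); exact: le_trans h h2.
Unshelve. all: by end_near. Qed.

End gauss_density.

Section std_normal_cdf.
Context {R : realType}.
Local Open Scope classical_set_scope.
Local Open Scope ring_scope.
Local Notation phi := (@gauss_density R).
Implicit Types x y w z : R.

(** The normal distribution function stays abstract: Stein's method uses only its derivative and its
    limits. [normal_law_std_cdf] supplies the instance from the law of [Z]. *)
Definition std_normal_cdf (F : R -> R) :=
  [/\ forall x, is_derive x 1 F (phi x), F x @[x --> -oo] --> (0 : R)
    & F x @[x --> +oo] --> (1 : R)].

(** Serves for Gaussian tail inequalities, where the limit at infinity takes the place of a value at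
    an endpoint. *)
Lemma nincr_cvg0_ge0 (g dg : R -> R) x :
  (forall y, x <= y -> is_derive y 1 g (dg y)) ->
  (forall y, x <= y -> dg y <= 0) -> g y @[y --> +oo] --> (0 : R) -> 0 <= g x.
Proof.
move=> gdg dg0 g0; rewrite leNgt; apply/negP => gx.
have : \forall y \near +oo, g x < g y by apply: (cvgr_gt _ g0).
move=> [M [_ hM]].
have [y xy My] : exists2 y, x <= y & M < y.
  by exists (`|x| + `|M| + 1); have := ler_norm x; have := ler_norm M;
    have := normr_ge0 x; have := normr_ge0 M; lra.
have := hM y My; rewrite ltNge -lerN2 => /negP; apply.
apply: (@is_derive_ge0_le _ (fun y => - g y) (fun y => - dg y)) => // t /andP[xt _].
  by have := gdg t xt => ?; exact: is_deriveN.
by rewrite oppr_ge0 dg0.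
Qed.

Context (Phi : R -> R) (Phi_cdf : std_normal_cdf Phi).

Let dPhi x : is_derive x 1 Phi (phi x). Proof. by have [] := Phi_cdf. Qed.

Lemma std_normal_cdf_ndecr x y : x <= y -> Phi x <= Phi y.
Proof.
move=> xy; apply: (@is_derive_ge0_le _ Phi phi) => // t _.
exact/ltW/gauss_density_gt0.
Qed.

Let dPhiN x : is_derive x 1 (fun y => Phi (- y)) (- phi x).
Proof.
have := dPhi (- x); rewrite gauss_densityN -(mulrN1 (phi x)) => h.
exact: (@is_derive1_comp _ Phi -%R).
Qed.

(** Phi(y) + Phi(-y) has zero derivative, and its constant value is read off at +oo. *)
Lemma std_normal_cdfN x : Phi (- x) = 1 - Phi x.
Proof.
apply/eqP; rewrite eq_sym subr_eq eq_sym addrC; apply/eqP.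
have cE y : Phi y + Phi (- y) = Phi x + Phi (- x).
  apply: (is_derive_0_is_cst (f := fun y => Phi y + Phi (- y))) => t.
  by have := is_deriveD (dPhi t) (dPhiN t); rewrite subrr.
have [_ Ny y1] := Phi_cdf.
have : Phi y + Phi (- y) @[y --> +oo] --> (1 + 0 : R).
  apply: cvgD => //.
  by move/cvgNy_compNP : Ny.
rewrite addr0 (_ : (fun y => Phi y + Phi (- y)) = cst (Phi x + Phi (- x))).
  by move=> /(cvg_unique (@Rhausdorff R) (cvg_cst _)).
exact/funext.
Qed.

Lemma std_normal_cdf0 : Phi 0 = 2^-1.
Proof. by have := std_normal_cdfN 0; rewrite oppr0; lra. Qed.

Lemma std_normal_cdf_ge0 x : 0 <= Phi x.
Proof.
rewrite -(opprK x); apply: (@nincr_cvg0_ge0 (fun y => Phi (- y)) (fun y => - phi y)).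
- by [].
- by move=> y _; rewrite oppr_le0 ltW ?gauss_density_gt0.
- by have [_ /cvgNy_compNP] := Phi_cdf.
Qed.

Lemma std_normal_cdf_le1 x : Phi x <= 1.
Proof. by rewrite -subr_ge0 -std_normal_cdfN std_normal_cdf_ge0. Qed.

End std_normal_cdf.

(** * Mills ratio and the Stein solution *)

Lemma is_derive_inv {R : realType} (f : R -> R) (x df : R) : f x != 0 ->
  is_derive x 1 f df -> is_derive x 1 (fun y => (f y)^-1) (- (f x) ^- 2 * df).
Proof.
move=> fx0 dfx; have dx : derivable f x 1 by [].
by split; [exact: derivableV|rewrite deriveV// derive_val].
Qed.

Section mills_ratio.
Context {R : realType}.
Local Open Scope classical_set_scope.
Local Open Scope ring_scope.
Local Notation phi := (@gauss_density R).
Context (Phi : R -> R) (Phi_cdf : std_normal_cdf Phi).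
Implicit Types x y w z : R.

Let dPhi x : is_derive x 1 Phi (phi x). Proof. by have [] := Phi_cdf. Qed.

Let dPhiN x : is_derive x 1 (fun y => Phi (- y)) (- phi x).
Proof.
have := dPhi (- x); rewrite gauss_densityN -(mulrN1 (phi x)) => h.
exact: (@is_derive1_comp _ Phi -%R).
Qed.

Definition mills w := Phi (- w) / phi w.

Lemma mills_gauss w : mills w * phi w = Phi (- w).
Proof. by rewrite divfK// gt_eqF// gauss_density_gt0. Qed.

Lemma mills_ge0 w : 0 <= mills w.
Proof.
apply: divr_ge0; first exact: std_normal_cdf_ge0.
exact/ltW/gauss_density_gt0.
Qed.

(** By this equation, constant multiples of R(w) and of R(-w) solve the Stein equation f' = w f + c
    on a half-line where c is constant. *)
Lemma is_derive_mills w : is_derive w 1 mills (w * mills w - 1).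
Proof.
have millsE : mills = fun y => Phi (- y) * (Num.sqrt (2 * pi) * expR (y ^+ 2 / 2)).
  by apply/funext => y; rewrite /mills /gauss_density expRN invfM !invrK.
rewrite millsE.
have h : is_derive w 1 (fun y : R => expR (y ^+ 2 / 2)) (expR (w ^+ 2 / 2) * w).
  apply: (@is_derive1_comp R expR (fun y => y ^+ 2 / 2)).
  by apply: is_derive_eq; rewrite /GRing.scale/=; field.
have h2 := dPhiN w.
apply: is_derive_eq; rewrite -[X in _ * X - 1](congr1 (@^~ w) millsE)/=.
have E : phi w * (Num.sqrt (2 * pi) * expR (w ^+ 2 / 2)) = 1.
  rewrite /gauss_density mulrACA mulVf ?mul1r.
    by rewrite expRN mulVf// gt_eqF// expR_gt0.
  by rewrite gt_eqF// sqrtr_gt0 mulr_gt0// pi_gt0.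
by rewrite millsE /GRing.scale/= -[X in _ = _ - X]E; ring.
Qed.

(** For w > 0 this is the tail bound Phi(-w) <= phi(w) / w: the difference tends to 0 and has
    derivative - phi(y) / y^2. *)
Lemma mul_mills_le1 w : w * mills w <= 1.
Proof.
have [w0|w0] := leP w 0.
  by apply: le_trans ler01; rewrite mulr_le0_ge0 ?mills_ge0.
rewrite mulrA ler_pdivrMr ?gauss_density_gt0// mul1r mulrC -ler_pdivlMr//.
rewrite -subr_ge0.
apply: (@nincr_cvg0_ge0 _ (fun y => phi y / y - Phi (- y)) (fun y => - (phi y / y
  ^+ 2))).
- move=> y wy; have y0 : y != 0 by rewrite gt_eqF// (lt_le_trans w0).
  have h1 := is_derive_gauss_density y; have h2 := dPhiN y.
  have h3 : is_derive y 1 (fun y : R => y^-1) (- (y ^- 2)).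
    by have := @is_derive_inv R id y 1 y0 (is_derive_id y 1); rewrite mulr1.
  by apply: is_derive_eq; rewrite /GRing.scale/=; field.
- move=> y wy; rewrite oppr_le0; apply: divr_ge0; last exact: sqr_ge0.
  exact/ltW/gauss_density_gt0.
- rewrite -(subr0 0); apply: cvgB; last by have [_ /cvgNy_compNP] := Phi_cdf.
  apply: (@squeeze_cvgr _ _ _ _ (cst 0) phi); last 2 first.
  + exact: cvg_cst.
  + exact: gauss_density_cvgy0.
  near=> y; have y1 : 1 < y by near: y; apply: nbhs_pinfty_gt; exact: num_real.
  have p0 := gauss_density_gt0 y.
  have y0 : 0 < y by lra.
  apply/andP; split; first by rewrite /= divr_ge0// ltW.
  by rewrite ler_pdivrMr//; nra.
Unshelve. all: by end_near. Qed.

(** The derivative of w R(w), where R is the Mills ratio. *)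
Definition stein_kernel w := (1 + w ^+ 2) * mills w - w.
Local Notation K := stein_kernel.

(** Equivalent to the tail bound Phi(-w) >= w phi(w) / (1 + w^2). The difference tends to 0 and has
    derivative - 2 phi(y) / (1 + y^2)^2. *)
Lemma stein_kernel_ge0 w : 0 <= K w.
Proof.
rewrite subr_ge0 mulrC -ler_pdivrMr; last by have := sqr_ge0 w; lra.
rewrite ler_pdivlMr ?gauss_density_gt0// -subr_ge0.
have d0 y : 1 + y ^+ 2 != 0 by apply: lt0r_neq0; have := sqr_ge0 y; lra.
apply: (@nincr_cvg0_ge0 _ (fun y => Phi (- y) - y / (1 + y ^+ 2) * phi y)
  (fun y => - (2 * phi y / (1 + y ^+ 2) ^+ 2))).
- move=> y wy.
  have h1 := is_derive_gauss_density y; have h2 := dPhiN y.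
  have h3 : is_derive y 1 (fun y : R => (1 + y ^+ 2)^-1)
      (- (1 + y ^+ 2) ^- 2 * (2 * y)).
    have h4 : is_derive y 1 (fun y : R => 1 + y ^+ 2) (2 * y).
      by apply: is_derive_eq; rewrite /GRing.scale/=; ring.
    exact: (@is_derive_inv R (fun y => 1 + y ^+ 2) y _ (d0 y) h4).
  by apply: is_derive_eq; rewrite /GRing.scale/=; field.
- move=> y wy; rewrite oppr_le0; apply: divr_ge0; last exact: sqr_ge0.
  by apply: mulr_ge0 => //; exact/ltW/gauss_density_gt0.
- rewrite -(subr0 0); apply: cvgB; first by have [_ /cvgNy_compNP] := Phi_cdf.
  apply: (@squeeze_cvgr _ _ _ _ (cst 0) phi); last 2 first.
  + exact: cvg_cst.
  + exact: gauss_density_cvgy0.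
  near=> y; have y1 : 1 < y by near: y; apply: nbhs_pinfty_gt; exact: num_real.
  have p0 := gauss_density_gt0 y.
  have y0 : 0 < 1 + y ^+ 2 by nra.
  apply/andP; split; first by rewrite /= mulr_ge0 ?divr_ge0 ?(ltW p0) ?(ltW y0)//; lra.
  by rewrite ler_piMl ?(ltW p0)// ler_pdivrMr//; nra.
Unshelve. all: by end_near. Qed.

Lemma mills_nincr x y : x <= y -> mills y <= mills x.
Proof.
move=> xy; rewrite -lerN2.
apply: (@is_derive_ge0_le _ (fun t => - mills t) (fun t => - (t * mills t - 1)))
  => // t _.
  by have := is_derive_mills t => ?; exact: is_deriveN.
by rewrite oppr_ge0 subr_le0 mul_mills_le1.
Qed.

Lemma mills0E : mills 0 * phi 0 = 2^-1.
Proof. by rewrite mills_gauss oppr0 (std_normal_cdf0 Phi_cdf). Qed.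

Lemma mills0_val : mills 0 = Num.sqrt (2 * pi) / 2.
Proof.
by rewrite /mills oppr0 (std_normal_cdf0 Phi_cdf) gauss_density0 invrK mulrC.
Qed.

Lemma mills0_ge1 : 1 <= mills 0.
Proof.
rewrite mills0_val ler_pdivlMr// mul1r -[leLHS]ger0_norm// -sqrtr_sqr.
rewrite ler_sqrt ?mulr_ge0 ?pi_ge0//; have := @pi_ge2 R; lra.
Qed.

(** If w R(0) <= 1, bounding R(w) by R(0) suffices. Otherwise w R(w) <= 1 gives w K(w) <= 1 < w
    R(0). *)
Lemma stein_kernel_le w : 0 <= w -> K w <= mills 0.
Proof.
move=> w0; have Rw := mills_nincr w0; have Rw1 := mul_mills_le1 w.
have R1 := mills0_ge1; have R0 := mills_ge0 w.
rewrite /stein_kernel; have [wc|wc] := leP (w * mills 0) 1; first by nra.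
have w_gt0 : 0 < w by rewrite lt_neqAle w0 andbT; apply: contraTneq wc => <-;
  rewrite mul0r -leNgt.
by rewrite -(ler_pM2l w_gt0); nra.
Qed.

(** For v >= 1 both factors are at most 1. For v < 1, Phi(v) <= 1/2 + phi(0) and K(v) <= R(0), and
    R(0) phi(0) = 1/2. *)
Lemma cdf_stein_kernel_le v : 0 <= v -> Phi v * K v <= (mills 0 + 1) / 2.
Proof.
move=> v0; have K0 := stein_kernel_ge0 v; have Kv := stein_kernel_le v0.
have Rw1 := mul_mills_le1 v; have R1 := mills0_ge1; have R0 := mills_ge0 v.
have P1 := std_normal_cdf_le1 Phi_cdf v; have P0 := std_normal_cdf_ge0 Phi_cdf v.
have [v1|v1] := leP 1 v.
  have K1 : K v <= 1 by rewrite /stein_kernel; nra.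
  by nra.
have Pv : Phi v <= 2^-1 + phi 0.
  rewrite -(std_normal_cdf0 Phi_cdf) -lerBlDl.
  have [||c _ ->] := @MVT_segment R Phi phi 0 v v0; first by move=> x _.
    by apply: derivable_within_continuous => x _; have [] := dPhi x.
  have := gauss_density_max c; have := gauss_density_gt0 c; nra.
have E := mills0E; have p0 := gauss_density_gt0 (0 : R).
apply: (@le_trans _ _ ((2^-1 + phi 0) * mills 0)); first by nra.
by rewrite mulrDl [phi 0 * _]mulrC E; lra.
Qed.

(** Controls (w f)' for the Stein solution f with threshold z, to the right of z. By monotonicity of
    Phi it is enough to take z = w. The natural bound contains |w|; replacing it by (1 + w^2) / 2
    gives a polynomial, whose binomial mean is explicit. *)
Lemma stein_bound z w : z <= w ->
  0 <= Phi z * K w <= mills 0 / 2 + 1 + w ^+ 2 / 2.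
Proof.
move=> zw; have K0 := stein_kernel_ge0 w; have z0 := std_normal_cdf_ge0 Phi_cdf z.
rewrite mulr_ge0//=.
suff : Phi w * K w <= (mills 0 + 1) / 2 + `|w|.
  have := std_normal_cdf_ndecr Phi_cdf zw.
  have : w ^+ 2 = `|w| ^+ 2 by rewrite real_normK// num_real.
  by have := sqr_ge0 (`|w| - 1); set v := `|w| => h1 -> h2 h3; nra.
have [w0|w0] := leP 0 w.
  by rewrite ger0_norm//; have := cdf_stein_kernel_le w0; lra.
rewrite ltr0_norm//.
have : 0 <= - w by lra.
move: (- w) (opprK w) => v <- {w zw K0 w0} v0.
(* Reflection reduces a negative argument to a positive one, and the extra v is the |w| of the
   target. *)
suff -> : Phi (- v) * K (- v) = Phi v * K v + v.
  by have := cdf_stein_kernel_le v0; lra.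
rewrite /stein_kernel; have -> : mills (- v) = Phi v / phi v.
  by rewrite /mills gauss_densityN opprK.
have E : Phi (- v) = mills v * phi v by rewrite mills_gauss.
have p0 : phi v != 0 by rewrite gt_eqF// gauss_density_gt0.
have -> : Phi v = 1 - mills v * phi v by rewrite -E (std_normal_cdfN Phi_cdf); ring.
by rewrite E sqrrN; field.
Qed.

End mills_ratio.

(** * The Stein equation over one lattice step *)

Section stein_step.
Context {R : realType}.
Implicit Types a t w : R.

(* [f] solves f' = w f + c, so [f w + w * (w * f w + c)] is (w f)'. Comparing
   the difference quotient of [f] with c plus a two-point average of w f
   costs at most half the width times the size of (w f)', weighted by [1 - p]
   from above and by [p] from below. *)
Lemma stein_step (f : R -> R) (c p A a t : R) : 0 < t -> 0 <= p <= 1 ->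
  (forall w, is_derive w 1 f (w * f w + c)) ->
  (forall w, a <= w <= a + t ->
     0 <= f w + w * (w * f w + c) <= A + w ^+ 2 / 2) ->
  let psi := (f (a + t) - f a) / t - (1 - p) * (a * f a)
             - p * ((a + t) * f (a + t)) - c in
  psi <= (1 - p) * (A * t / 2 + a ^+ 2 * t / 4 + a * t ^+ 2 / 6 + t ^+ 3 / 24) /\
  - psi <= p * (A * t / 2 + a ^+ 2 * t / 4 + a * t ^+ 2 / 3 + t ^+ 3 / 8).
Proof.
move=> t0 /andP[p0 p1] df hb psi.
pose h w := w * f w.
have dh w : is_derive w 1 h (f w + w * (w * f w + c)).
  by have ? := df w; apply: is_derive_eq; rewrite /GRing.scale/=; ring.
have dshift (g : R -> R) (dg : R) s : is_derive (a + s) 1 g dg ->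
    is_derive s 1 (fun y => g (a + y)) dg.
  move=> gdg; rewrite -(mulr1 dg).
  apply: (@is_derive1_comp R g (fun y => a + y)).
  by apply: is_derive_eq; rewrite add0r mulr1.
have h_ndecr (s : R) : 0 <= s <= t -> 0 <= h (a + s) - h a.
  move=> /andP[s0 st]; rewrite subr_ge0; apply: is_derive_ge0_le (fun w _ => dh w) _.
    by lra.
  by move=> w /andP[w1 w2]; have /hb /andP[] : a <= w <= a + t by apply/andP; lra.
have h_lip (s : R) : 0 <= s <= t ->
    h (a + s) - h a <= A * s + (a ^+ 2 * s + a * s ^+ 2) / 2 + s ^+ 3 / 6.
  move=> /andP[s0 st]; pose g w := A * w + w ^+ 3 / 6 - h w.
  have : g a <= g (a + s).
    apply: (@is_derive_ge0_le _ g
      (fun w => A + w ^+ 2 / 2 - (f w + w * (w * f w + c)))) => //.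
    - by lra.
    - by move=> w _; have ? := dh w; apply: is_derive_eq; rewrite /GRing.scale/=; field.
    move=> w /andP[w1 w2]; have /hb /andP[_] : a <= w <= a + t by apply/andP; lra.
    by rewrite subr_ge0.
  rewrite /g -subr_ge0 => gg; rewrite -subr_ge0; apply: le_trans gg _.
  by rewrite le_eqVlt; apply/orP; left; apply/eqP; field.
(* Psi(s) is s times the error for width s. Its derivative is (1 - p) (h(a + s) - h(a)) - s p h'(a +
   s). Both h(a + s) - h(a) and h' are nonnegative, so the upper bound drops the second term and the
   lower bound drops the first; what remains is integrated from 0 to t. *)
pose Psi s := f (a + s) - f a - s * ((1 - p) * h a) - s * (p * h (a + s)) - c * s.
have Psi0 : Psi 0 = 0 by rewrite /Psi addr0; ring.
have psiE : psi = Psi t / t by rewrite /psi /Psi /h; field; exact: lt0r_neq0.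
have dPsi (s : R) : is_derive s 1 Psi ((1 - p) * (h (a + s) - h a)
    - s * p * (f (a + s) + (a + s) * ((a + s) * f (a + s) + c))).
  have ? := dshift _ _ _ (df (a + s)); have ? := dshift _ _ _ (dh (a + s)).
  by apply: is_derive_eq; rewrite /GRing.scale/= /h; ring.
rewrite psiE; split.
- rewrite ler_pdivrMr// -subr_ge0.
  pose g s := (1 - p) * (A * s ^+ 2 / 2 + a ^+ 2 * s ^+ 2 / 4 + a * s ^+ 3 / 6
    + s ^+ 4 / 24) - Psi s.
  have : g 0 <= g t.
    apply: (@is_derive_ge0_le _ g (fun s => (1 - p) * (A * s
      + (a ^+ 2 * s + a * s ^+ 2) / 2 + s ^+ 3 / 6)
      - ((1 - p) * (h (a + s) - h a)
    - s * p * (f (a + s) + (a + s) * ((a + s) * f (a + s) + c))))).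
    - exact: ltW.
    - by move=> s _; have ? := dPsi s; apply: is_derive_eq;
      rewrite /GRing.scale/=; field.
    move=> s /andP[s0 st].
    have /hb /andP[h1 _] : a <= a + s <= a + t by apply/andP; lra.
    have /h_lip h2 : 0 <= s <= t by rewrite s0.
    rewrite opprB addrA addrAC -mulrBr addr_ge0//.
      by apply: mulr_ge0; rewrite subr_ge0.
    by apply: mulr_ge0 => //; exact: mulr_ge0.
  have -> : g 0 = 0 by rewrite /g Psi0 !expr0n/=; ring.
  by congr (_ <= _); rewrite /g; field.
- rewrite -mulNr ler_pdivrMr// -subr_ge0 opprK.
  pose g s := p * (A * s ^+ 2 / 2 + a ^+ 2 * s ^+ 2 / 4 + a * s ^+ 3 / 3
    + s ^+ 4 / 8) + Psi s.
  have : g 0 <= g t.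
    apply: (@is_derive_ge0_le _ g (fun s => s * p * (A + (a + s) ^+ 2 / 2)
      + ((1 - p) * (h (a + s) - h a)
    - s * p * (f (a + s) + (a + s) * ((a + s) * f (a + s) + c))))).
    - exact: ltW.
    - by move=> s _; have ? := dPsi s; apply: is_derive_eq;
      rewrite /GRing.scale/=; field.
    move=> s /andP[s0 st].
    have /hb /andP[_ h1] : a <= a + s <= a + t by apply/andP; lra.
    have /h_ndecr h2 : 0 <= s <= t by rewrite s0.
    rewrite addrCA -mulrBr addr_ge0//.
      by apply: mulr_ge0 => //; rewrite subr_ge0.
    by apply: mulr_ge0; [exact: mulr_ge0|rewrite subr_ge0].
  have -> : g 0 = 0 by rewrite /g Psi0 !expr0n/=; ring.
  by congr (_ <= _); rewrite /g; field.
Qed.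

End stein_step.

(** * The binomial law *)

Section binomial_mean.
Context {R : realType} (p : R).
Local Notation q := (1 - p).
Implicit Types (m k : nat) (u v : nat -> R).

(* The mean of [u] under the binomial law with parameters [m] and [p], by
   conditioning on the outcome of one trial. *)
Fixpoint binomial_mean m u : R :=
  if m is m'.+1 then binomial_mean m' (fun k => q * u k + p * u k.+1) else u 0%N.
Local Notation E := binomial_mean.

Lemma binomial_mean_lin m a b u v :
  E m (fun k => a * u k + b * v k) = a * E m u + b * E m v.
Proof.
elim: m u v => [|m IH] u v //=; rewrite -IH; congr E; apply/funext => k; ring.
Qed.

Lemma binomial_mean_cst m a : E m (fun=> a) = a.
Proof.
by elim: m => [|m IH] //=; rewrite -[RHS]IH; congr E; apply/funext => k; ring.
Qed.

Lemma binomial_meanD m u v : E m (fun k => u k + v k) = E m u + E m v.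
Proof.
rewrite -[E m u]mul1r -[E m v]mul1r -binomial_mean_lin.
by congr E; apply/funext => k; rewrite !mul1r.
Qed.

Lemma binomial_meanZ m a u : E m (fun k => a * u k) = a * E m u.
Proof.
rewrite -[RHS]addr0 -(mul0r (E m u)) -binomial_mean_lin.
by congr E; apply/funext => k; ring.
Qed.

(** Stein identity of the binomial law. Conditioning on one trial turns the left side into the same
    expression for the averaged function q u(k) + p u(k + 1), plus p q (u(k + 1) - u(k)). *)
Lemma binomial_mean_stein m u :
  E m.+1 (fun k => (k%:R - m.+1%:R * p) * u k) =
  m.+1%:R * p * q * E m (fun k => u k.+1 - u k).
Proof.
elim: m u => [|m IH] u; first by rewrite /=; ring.
have -> : E m.+2 (fun k => (k%:R - m.+2%:R * p) * u k) =
  E m.+1 (fun k => 1 * ((k%:R - m.+1%:R * p) * (q * u k + p * u k.+1)) +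
     (p * q) * (u k.+1 - u k)).
  rewrite [LHS]/=; congr E; apply/funext => k.
  by rewrite -!natr1; ring.
rewrite binomial_mean_lin IH mul1r.
have -> : E m (fun k => q * u k.+1 + p * u k.+2 - (q * u k + p * u k.+1)) =
    E m.+1 (fun k => u k.+1 - u k).
  by congr E; apply/funext => k; ring.
by rewrite -[m.+2%:R]natr1; ring.
Qed.

Lemma binomial_mean_id m : E m (fun k => k%:R) = m%:R * p.
Proof.
case: m => [|m]; first by rewrite mul0r.
have := binomial_mean_stein m (fun=> 1).
rewrite subrr binomial_mean_cst mulr0 => h.
apply/eqP; rewrite -subr_eq0 -{}h -[X in _ - X](binomial_mean_cst m.+1) -mulN1r.
rewrite -binomial_meanZ -binomial_meanD.
by apply/eqP; congr E; apply/funext => k; ring.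
Qed.

Lemma binomial_mean_var m : E m (fun k => (k%:R - m%:R * p) ^+ 2) = m%:R * p * q.
Proof.
case: m => [|m]; first by rewrite /= !mul0r subrr expr0n.
have := binomial_mean_stein m (fun k => k%:R - m.+1%:R * p).
have -> : (fun k => k.+1%:R - m.+1%:R * p - (k%:R - m.+1%:R * p)) = (fun=> 1).
  by apply/funext => k; rewrite -[k.+1%:R]natr1; ring.
by rewrite binomial_mean_cst mulr1.
Qed.

Context (p01 : 0 <= p <= 1).

Lemma binomial_mean_le m u v : (forall k, u k <= v k) -> E m u <= E m v.
Proof.
have /andP[p0 p1] := p01.
elim: m u v => [|m IH] u v uv //=; apply: IH => k.
by rewrite lerD// ler_wpM2l// subr_ge0.
Qed.

(** The increment of the indicator of k > j is the indicator of k = j, so the Stein identity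
    expresses v e as the mean of d over the event k > j, d being the deviation. There d <= (d + s)^2
    / (4 s), whose mean is s / 2. *)
Lemma binomial_pmf_le m j : 0 < m.+1%:R * p * q ->
  E m (fun k => (k == j)%:R) <= (2 * Num.sqrt (m.+1%:R * p * q))^-1.
Proof.
set v := _ * q => v0; set s := Num.sqrt v.
have s0 : 0 < s by rewrite sqrtr_gt0.
have s2 : s ^+ 2 = v by rewrite sqr_sqrtr// ltW.
have := binomial_mean_stein m (fun k => (j < k)%N%:R).
have -> : (fun k => (j < k.+1)%N%:R - (j < k)%N%:R) = (fun k => (k == j)%:R) :>
  (nat -> R).
  apply/funext => k; rewrite ltnS [in LHS]leq_eqVlt eq_sym.
  by case: eqVneq => [->|_]; rewrite ?ltnn ?subr0//= subrr.
rewrite -/v; set e := E m _ => h.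
have : v * e <= E m.+1 (fun k => 4^-1 / s * (k%:R - m.+1%:R * p) ^+ 2
    + (2^-1 * (k%:R - m.+1%:R * p) + s / 4)).
  rewrite -h; apply: binomial_mean_le => k; set d := _ - _ * p.
  have -> : 4^-1 / s * d ^+ 2 + (2^-1 * d + s / 4) = (d + s) ^+ 2 / (4 * s).
    by field; exact: lt0r_neq0.
  case: ltnP => _; last by rewrite mulr0 divr_ge0 ?sqr_ge0// mulr_ge0// ltW.
  by rewrite mulr1 ler_pdivlMr ?mulr_gt0//; have := sqr_ge0 (d - s); nra.
rewrite !binomial_meanD !binomial_meanZ binomial_mean_var binomial_mean_cst.
rewrite binomial_meanD binomial_mean_id binomial_mean_cst subrr mulr0 add0r.
rewrite -/v -s2 => h2.
rewrite -[leRHS]mul1r ler_pdivlMr ?mulr_gt0//.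
have : s ^+ 2 * e <= s / 2.
  by apply: le_trans h2 _; rewrite le_eqVlt; apply/orP; left; apply/eqP; field;
    exact: lt0r_neq0.
by nra.
Qed.

End binomial_mean.

(** * A Berry-Esseen bound for the binomial law *)

Section binomial_berry_esseen.
Context {R : realType}.
Local Notation phi := (@gauss_density R).
Context (Phi : R -> R) (Phi_cdf : std_normal_cdf Phi).
Context (p : R) (p01 : 0 < p < 1) (m : nat).
Local Notation q := (1 - p).
Local Notation E := (binomial_mean p).
Local Notation R_ := (mills Phi).
Let v := m.+1%:R * p * q.
Let s := Num.sqrt v.
Let x (k : nat) := (k%:R - m.+1%:R * p) / s.

Let p_gt0 : 0 < p. Proof. by have /andP[] := p01. Qed.
Let q_gt0 : 0 < q. Proof. by rewrite subr_gt0; have /andP[] := p01. Qed.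
Let v_gt0 : 0 < v. Proof. by rewrite !mulr_gt0. Qed.
Let s_gt0 : 0 < s. Proof. by rewrite sqrtr_gt0. Qed.
Let sE : s ^+ 2 = v. Proof. by rewrite sqr_sqrtr// ltW. Qed.
Let s_neq0 : s != 0. Proof. exact: lt0r_neq0. Qed.
Let pW : 0 <= p <= 1. Proof. by rewrite !ltW//; have /andP[] := p01. Qed.

Let xS k : x k.+1 = x k + s^-1.
Proof. by rewrite /x -[k.+1%:R]natr1; field. Qed.

Let x_le i j : (i <= j)%N -> x i <= x j.
Proof. by move=> ij; rewrite ler_pM2r ?invr_gt0// lerB// ler_nat. Qed.

(** The solution of f' = w f + c at the lattice point x_k, where c is the indicator of w <= x_j
    minus Phi(x_j). *)
Let stein_sol j k := if (k <= j)%N then Phi (- x j) * R_ (- x k)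
  else Phi (x j) * R_ (x k).

(** The error of the lattice Stein equation on the interval from x_k to x_(k+1); this interval lies
    to the left of x_j exactly when k < j. *)
Let psi j k := (stein_sol j k.+1 - stein_sol j k) / s^-1
  - q * (x k * stein_sol j k) - p * (x k.+1 * stein_sol j k.+1)
  - ((k < j)%N%:R - Phi (x j)).

(** The threshold is a lattice point, so every lattice interval lies on one side of it and
    [stein_step] applies to a single smooth branch. *)
Let psi_bound j k : let t := s^-1 in let A := R_ 0 / 2 + 1 in let a := x k in
  psi j k <= q * (A * t / 2 + a ^+ 2 * t / 4 + a * t ^+ 2 / 6 + t ^+ 3 / 24) /\
  - psi j k <= p * (A * t / 2 + a ^+ 2 * t / 4 + a * t ^+ 2 / 3 + t ^+ 3 / 8).
Proof.
move=> t A a; have t0 : 0 < t by rewrite invr_gt0.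
rewrite /psi xS /stein_sol.
have [kj|jk] := ltnP k j.
- rewrite (ltnW kj) xS -(std_normal_cdfN Phi_cdf).
  apply: (@stein_step _ (fun w => Phi (- x j) * R_ (- w)) _ p A) => //.
  + move=> w; have h := is_derive_mills Phi_cdf (- w).
    have h2 : is_derive w 1 (fun y => R_ (- y)) ((- w * R_ (- w) - 1) * -1).
      exact: (@is_derive1_comp R R_ -%R).
    by apply: is_derive_eq; rewrite /GRing.scale/=; ring.
  + move=> w /andP[_ wb].
    have : - x j <= - w by rewrite lerN2 (le_trans wb)// -xS x_le.
    move=> /(stein_bound Phi_cdf); rewrite sqrrN.
    rewrite [Phi _ * _](_ : _ = Phi (- x j) * R_ (- w)
      + w * (w * (Phi (- x j) * R_ (- w)) + Phi (- x j)))//.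
    by rewrite /stein_kernel; ring.
(* At k = j the left endpoint is evaluated on the other branch; the two branches agree there. *)
- have -> : (if (k <= j)%N then Phi (- x j) * R_ (- x k) else Phi (x j) * R_ (x k))
      = Phi (x j) * R_ (x k).
    case: leqP => // kj; have -> : k = j by apply/eqP; rewrite eqn_leq kj jk.
    by rewrite /mills gauss_densityN opprK mulrCA mulrC.
  rewrite sub0r xS.
  apply: (@stein_step _ (fun w => Phi (x j) * R_ w) _ p A) => //.
  + move=> w; have h := is_derive_mills Phi_cdf w.
    by apply: is_derive_eq; rewrite /GRing.scale/=; ring.
  + move=> w /andP[wa _].
    have : x j <= w by rewrite (le_trans _ wa)// x_le.
    move=> /(stein_bound Phi_cdf).
    rewrite [Phi _ * _](_ : _ = Phi (x j) * R_ w
      + w * (w * (Phi (x j) * R_ w) + - Phi (x j)))//.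
    by rewrite /stein_kernel; ring.
Qed.

(** The weights q and p of the endpoints are those of one further trial, so the mean of the averaged
    terms is that of x f under m + 1 trials. The Stein identity equates it with the mean difference
    quotient, and only the indicator term survives. *)
Let mean_psi j : E m (psi j) = Phi (x j) - E m (fun k => (k < j)%N%:R).
Proof.
have h := binomial_mean_stein p m (stein_sol j).
have : E m.+1 (fun k => s^-1 * ((k%:R - m.+1%:R * p) * stein_sol j k)) =
    E m (fun k => s * (stein_sol j k.+1 - stein_sol j k)).
  rewrite !binomial_meanZ h -/v -sE mulrA; congr (_ * _); field.
  exact: s_neq0.
rewrite [LHS]/=; set G := (fun k => _ + _); set D := (fun k => s * _).
have -> : psi j = (fun k => 1 * D k
    + (-1) * (1 * G k + 1 * (1 * (k < j)%N%:R + (-1) * Phi (x j)))).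
  by apply/funext => k; rewrite /psi /G /D /x invrK; ring.
move: G D => G D GD; rewrite !binomial_mean_lin GD binomial_mean_cst; ring.
Qed.

(** Here [x] is standardized for m + 1 trials but averaged over m trials, whence the correction here
    and in [mean_x2]. *)
Let mean_x : E m x = - p / s.
Proof.
have -> : E m x = E m (fun k => s^-1 * k%:R + (- (m.+1%:R * p)) * s^-1).
  by congr E; apply/funext => k; rewrite /x; ring.
rewrite binomial_meanD binomial_meanZ binomial_mean_cst binomial_mean_id.
by rewrite -[m.+1%:R]natr1; ring.
Qed.

Let mean_x2 : E m (fun k => x k ^+ 2) = 1 + (p ^+ 2 - p * q) / v.
Proof.
have -> : E m (fun k => x k ^+ 2) = E m (fun k => v^-1 * (k%:R - m%:R * p) ^+ 2 +
   (- (2 * p / v) * k%:R + (p ^+ 2 + 2 * m%:R * p ^+ 2) / v)).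
  congr E; apply/funext => k; rewrite /x -sE -[m.+1%:R]natr1; field.
  exact: s_neq0.
rewrite !binomial_meanD !binomial_meanZ binomial_mean_cst binomial_mean_id.
rewrite binomial_mean_var.
have -> : m%:R * p * q = v - p * q by rewrite /v -[m.+1%:R]natr1; ring.
rewrite mulrBr mulVf; last exact: lt0r_neq0.
ring.
Qed.

Let mean_poly (a b c d : R) :
  E m (fun k => a * (b + x k ^+ 2 * c + x k * d)) =
  a * (b + (1 + (p ^+ 2 - p * q) / v) * c - p / s * d).
Proof.
rewrite binomial_meanZ; congr (_ * _).
have -> : E m (fun k => b + x k ^+ 2 * c + x k * d) =
    E m (fun k => c * x k ^+ 2 + (d * x k + b)).
  by congr E; apply/funext => k; ring.
rewrite !binomial_meanD !binomial_meanZ binomial_mean_cst mean_x mean_x2; ring.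
Qed.

(** Half of the constant R(0) / 2 + 1 from [stein_bound], plus 1/4 from x^2 / 4, as the mean of x^2
    is close to 1. *)
Let C0 := R_ 0 / 4 + 3 / 4.

Let trial_cdf_bounds j : 1 <= s ->
  Phi (x j) - (q * C0 + 24^-1) / s <= E m (fun k => (k < j)%N%:R)
  <= Phi (x j) + (p * C0 + 24^-1) / s.
Proof.
move=> s1.
have v1 : v^-1 <= 1 by rewrite invf_le1// -sE exprn_ege1.
have v0 : 0 <= v^-1 by rewrite invr_ge0 ltW.
have pp := p_gt0; have qq := q_gt0.
(* After averaging, the lower-order terms of the upper and lower bounds are the same cubic,
   evaluated at q and at p respectively. *)
have key (y : R) : 0 < y < 1 ->
    y * (y ^+ 2 / 2 - 7 / 12 * y + 8^-1) / v <= 24^-1.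
  move=> /andP[y0 y1].
  have h : y * (y ^+ 2 / 2 - 7 / 12 * y + 8^-1) <= 24^-1.
    by have := sqr_ge0 (3 * y - 1); nra.
  apply: (@le_trans _ _ (24^-1 / v)); first by rewrite ler_wpM2r.
  by rewrite ler_piMr.
have hu : E m (psi j) <= (q * C0 + 24^-1) / s.
  apply: (@le_trans _ _ (E m (fun k => q * ((R_ 0 / 2 + 1) * s^-1 / 2 + s^-1 ^+ 3 / 24
      + x k ^+ 2 * (s^-1 / 4) + x k * (s^-1 ^+ 2 / 6))))).
    apply: (binomial_mean_le pW) => k; have [+ _] := psi_bound j k.
    by move=> /le_trans; apply; rewrite le_eqVlt; apply/orP; left; apply/eqP; ring.
  rewrite mean_poly.
  have -> : q * ((R_ 0 / 2 + 1) / s / 2 + s^-1 ^+ 3 / 24 +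
      (1 + (p ^+ 2 - p * q) / v) * (s^-1 / 4) - p / s * (s^-1 ^+ 2 / 6)) =
      (q * C0 + q * (q ^+ 2 / 2 - 7 / 12 * q + 8^-1) / v) / s.
    by rewrite -sE /C0; field; exact: s_neq0.
  rewrite ler_wpM2r ?invr_ge0 ?(ltW s_gt0)// lerD2l key// qq/=.
  by rewrite gtrBl.
have hl : - E m (psi j) <= (p * C0 + 24^-1) / s.
  rewrite -mulN1r -binomial_meanZ.
  apply: (@le_trans _ _ (E m (fun k => p * ((R_ 0 / 2 + 1) * s^-1 / 2 + s^-1 ^+ 3 / 8
      + x k ^+ 2 * (s^-1 / 4) + x k * (s^-1 ^+ 2 / 3))))).
    apply: (binomial_mean_le pW) => k; have [_ +] := psi_bound j k.
    by rewrite mulN1r => /le_trans; apply; rewrite le_eqVlt; apply/orP; left;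
      apply/eqP; ring.
  rewrite mean_poly.
  have -> : p * ((R_ 0 / 2 + 1) / s / 2 + s^-1 ^+ 3 / 8 +
      (1 + (p ^+ 2 - p * q) / v) * (s^-1 / 4) - p / s * (s^-1 ^+ 2 / 3)) =
      (p * C0 + p * (p ^+ 2 / 2 - 7 / 12 * p + 8^-1) / v) / s.
    by rewrite -sE /C0; field; exact: s_neq0.
  by rewrite ler_wpM2r ?invr_ge0 ?(ltW s_gt0)// lerD2l key.
move: hu hl; rewrite mean_psi => hu hl; apply/andP; split; lra.
Qed.

Let C0_ge : 2^-1 <= C0.
Proof. by rewrite /C0; have := mills0_ge1 Phi_cdf; lra. Qed.

Let pmf_le j : E m (fun k => (k == j)%:R) <= 2^-1 / s.
Proof. by rewrite -invfM; exact: binomial_pmf_le. Qed.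

(** The last trial changes the distribution function by p times a point probability, at most p / (2
    s). As C0 >= 1/2, this fits into the gap between q C0 and C0. [cdf_upper] exchanges p and q. *)
Let cdf_lower j : 1 <= s ->
  Phi (x j) - (C0 + 24^-1) / s <= E m.+1 (fun k => (k < j)%N%:R).
Proof.
move=> s1; have /andP[h _] := trial_cdf_bounds j s1.
have -> : E m.+1 (fun k => (k < j)%N%:R) =
    E m (fun k => (k < j)%N%:R) - p * E m (fun k => (k.+1 == j)%:R).
  rewrite /= -mulNr -binomial_meanZ -binomial_meanD; congr E; apply/funext => k.
  by case: (ltngtP k.+1 j) => kj; rewrite ?kj ?(ltnW kj) ?ltnSn//=; ring.
have : p * E m (fun k => (k.+1 == j)%:R) <= p * (2^-1 / s).
  rewrite ler_pM2l//; case: j {h} => [|j]; last exact: pmf_le.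
  by rewrite binomial_mean_cst divr_ge0 ?(ltW s_gt0).
move=> h2.
have : (q * C0 + 24^-1) / s + p * (2^-1 / s) <= (C0 + 24^-1) / s.
  rewrite mulrA -mulrDl ler_pM2r ?invr_gt0//.
  by have := C0_ge; have := p_gt0; nra.
lra.
Qed.

Let cdf_upper j : 1 <= s ->
  E m.+1 (fun k => (k < j.+1)%N%:R) <= Phi (x j) + (C0 + 24^-1) / s.
Proof.
move=> s1; have /andP[_ h] := trial_cdf_bounds j s1.
have -> : E m.+1 (fun k => (k < j.+1)%N%:R) =
    E m (fun k => (k < j)%N%:R) + q * E m (fun k => (k == j)%:R).
  rewrite /= -binomial_meanZ -binomial_meanD; congr E; apply/funext => k.
  by rewrite !ltnS; case: (ltngtP k j) => kj //=; ring.
have : q * E m (fun k => (k == j)%:R) <= q * (2^-1 / s).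
  by rewrite ler_pM2l// pmf_le.
have : (p * C0 + 24^-1) / s + q * (2^-1 / s) <= (C0 + 24^-1) / s.
  rewrite mulrA -mulrDl ler_pM2r ?invr_gt0//.
  by have := C0_ge; have := q_gt0; nra.
lra.
Qed.

Let berry_esseen_const : R := (Num.sqrt 10 + 3) / (3 * Num.sqrt pi).

(** Makes the Berry-Esseen bound trivial when s < 1. *)
Let const_ge1 : 1 <= berry_esseen_const.
Proof.
rewrite ler_pdivlMr ?mulr_gt0 ?sqrtr_gt0 ?pi_gt0// mul1r.
have h : Num.sqrt pi <= 2 :> R.
  rewrite -[leRHS]ger0_norm// -sqrtr_sqr ler_sqrt ?exprn_ge0//.
  by have := @pi_le_33_10 R; lra.
have : 3 <= Num.sqrt 10 :> R.
  rewrite -[leLHS]ger0_norm// -sqrtr_sqr ler_sqrt//; lra.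
lra.
Qed.

Let C0_le : C0 + 24^-1 <= berry_esseen_const.
Proof.
rewrite ler_pdivlMr ?mulr_gt0 ?sqrtr_gt0 ?pi_gt0//.
rewrite /C0 mills0_val// sqrtrM//.
have h : Num.sqrt pi <= 182 / 100 :> R.
  rewrite -[leRHS]ger0_norm// -sqrtr_sqr ler_sqrt ?exprn_ge0//.
  by have := @pi_le_33_10 R; lra.
have : 316 / 100 <= Num.sqrt 10 :> R.
  rewrite -[leLHS]ger0_norm// -sqrtr_sqr ler_sqrt//; lra.
have : Num.sqrt 2 <= 142 / 100 :> R.
  rewrite -[leRHS]ger0_norm// -sqrtr_sqr ler_sqrt ?exprn_ge0//; lra.
have := @sqrtr_ge0 R pi; have := @sqrtr_ge0 R 2; nra.
Qed.

Lemma binomial_berry_esseen (y : R) :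
  `|E m.+1 (fun k => ((k%:R - m.+1%:R * p) / s <= y)%R%:R) - Phi y|
  <= berry_esseen_const / s.
Proof.
have [s1|s1] := leP 1 s; last first.
  apply: (@le_trans _ _ 1); last first.
    by rewrite ler_pdivlMr// mul1r (le_trans (ltW s1)).
  have P1 := std_normal_cdf_le1 Phi_cdf y; have P0 := std_normal_cdf_ge0 Phi_cdf y.
  set e := E _ _.
  have : 0 <= e by rewrite -[0](binomial_mean_cst p m.+1); apply: (binomial_mean_le pW).
  have : e <= 1.
    rewrite -[1](binomial_mean_cst p m.+1); apply: (binomial_mean_le pW) => k.
    by case: (_ <= y).
  by rewrite ler_norml; lra.
apply: (@le_trans _ _ ((C0 + 24^-1) / s)); last by rewrite ler_pM2r ?invr_gt0.
(* The event is k < j, with j one more than the integer part of the threshold, or 0 if the threshold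
   is negative. Then y <= x_j, which gives the lower bound, and for j > 0 also x_(j-1) <= y, which
   gives the upper one. *)
have [j hj] : exists j, forall k, (x k <= y) = (k < j)%N.
  have [a0|a0] := ltP (y * s + m.+1%:R * p) 0.
    exists 0%N => k; rewrite ltn0 /x ler_pdivrMr// lerBlDr.
    by apply/negbTE; rewrite -ltNge (lt_le_trans a0).
  exists (Num.truncn (y * s + m.+1%:R * p)).+1 => k.
  by rewrite ltnS /x ler_pdivrMr// lerBlDr truncn_ge_nat.
have -> : (fun k => (x k <= y)%R%:R) = (fun k => (k < j)%N%:R) :> (nat -> R).
  by apply/funext => k; rewrite hj.
have yj : y <= x j by apply: ltW; rewrite ltNge hj ltnn.
have := cdf_lower j s1; have := std_normal_cdf_ndecr Phi_cdf yj.
case: j hj {yj} => [|j] hj.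
  rewrite binomial_mean_cst => h1 h2.
  by have := std_normal_cdf_ge0 Phi_cdf y; rewrite ler_norml; lra.
have jy : x j <= y by rewrite hj.
have := cdf_upper j s1; have := std_normal_cdf_ndecr Phi_cdf jy.
by rewrite ler_norml; lra.
Qed.

End binomial_berry_esseen.

(** * Normal approximation with a random number of trials *)

Section random_sample_size.
Context {R : realType}.
Local Notation phi := (@gauss_density R).
Implicit Types x y u s : R.

(* Bounding [b / sqrt x] by a quadratic in [x - 1] makes the linear term vanish
   once [x] is averaged over a law of mean 1. *)
Lemma inv_sqrt_le_quad (b e x : R) : 0 <= b <= 1 -> 0 <= x -> e <= 1 ->
  (0 < x -> e <= b / Num.sqrt x) ->
  e <= b - b / 2 * (x - 1) + 2 * (x - 1) ^+ 2.
Proof.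
(* For x <= 1/4 the quadratic term alone is at least 9/8. *)
move=> /andP[b0 b1] x0 e1 eb; have [x4|x4] := leP x (4^-1); first by nra.
have xp : 0 < x by apply: lt_trans x4.
apply: le_trans (eb xp) _.
have r0 : 0 < Num.sqrt x by rewrite sqrtr_gt0.
have r2 : 2^-1 <= Num.sqrt x.
  rewrite -[leLHS]ger0_norm// -sqrtr_sqr ler_sqrt// ltW//.
  by apply: le_lt_trans x4; lra.
rewrite -{2 3}(sqr_sqrtr x0); move: (Num.sqrt x) r0 r2 => r r0 r2.
rewrite ler_pdivrMr// -subr_ge0.
(* With r = sqrt x, the difference multiplied by r is affine in b. The next two terms are b times
   its value at b = 1 and 1 - b times its value at b = 0. *)
have : 0 <= b * ((r - 1) ^+ 2 * (2 * r * (r + 1) ^+ 2 - (r + 2) / 2)).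
  by rewrite mulr_ge0// mulr_ge0 ?sqr_ge0//; nra.
have : 0 <= (1 - b) * (2 * (r ^+ 2 - 1) ^+ 2 * r).
  by rewrite mulr_ge0 ?subr_ge0// mulr_ge0 ?(ltW r0)// mulr_ge0 ?sqr_ge0.
move=> h1 h2; apply: (le_trans (addr_ge0 h1 h2)).
by rewrite le_eqVlt; apply/orP; left; apply/eqP; field.
Qed.

Lemma gauss_density0_le : phi 0 <= 2^-1.
Proof.
rewrite gauss_density0 lef_pV2 ?posrE ?sqrtr_gt0 ?mulr_gt0 ?pi_gt0//.
rewrite -[leLHS]ger0_norm// -sqrtr_sqr ler_sqrt ?mulr_ge0 ?pi_ge0//.
by have := @pi_ge2 R; lra.
Qed.

Lemma gauss_density_mul_le u : `|u * phi u| <= 2^-1.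
Proof.
rewrite normrM (ger0_norm (ltW (gauss_density_gt0 u))).
apply: le_trans gauss_density0_le; apply: le_trans (gauss_density_le u).
rewrite ler_pM2r ?gauss_density_gt0// -(real_normK (num_real u)).
by have := sqr_ge0 (`|u| - 1); nra.
Qed.

(** Squaring e^(u^2 / 4) >= 1 + u^2 / 4 gives a quartic decay, which dominates the cube. *)
Lemma gauss_density_cube_le u : `|u ^+ 3 * phi u| <= 3 / 2.
Proof.
rewrite normrM (ger0_norm (ltW (gauss_density_gt0 u))) normrX.
have u2 : u ^+ 2 = `|u| ^+ 2 by rewrite real_normK// num_real.
have : (1 + u ^+ 2 / 4) ^+ 2 * phi u <= phi 0.
  rewrite gauss_density0 mulrC -mulrA ler_piMr ?invr_ge0// expRN.
  rewrite ler_pdivrMl ?expR_gt0// mulr1.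
  have -> : u ^+ 2 / 2 = u ^+ 2 / 4 + u ^+ 2 / 4 by field.
  by rewrite expRD -expr2 ler_sqr ?nnegrE ?expR_ge0 ?expR_ge1Dx//; nra.
have := gauss_density0_le; have p0 := gauss_density_gt0 u.
rewrite u2; set w := `|u| => h1 h2.
have : w ^+ 3 <= 3 * (1 + w ^+ 2 / 4) ^+ 2.
  rewrite -subr_ge0.
  have -> : 3 * (1 + w ^+ 2 / 4) ^+ 2 - w ^+ 3 =
    3 / 16 * w ^+ 2 * (w - 8 / 3) ^+ 2 + (w ^+ 2 / 6 + 3) by field.
  by apply: addr_ge0; [apply: mulr_ge0; [apply: mulr_ge0; [lra|]|];
    exact: sqr_ge0|have := sqr_ge0 w; lra].
by nra.
Qed.

Context (Phi : R -> R) (Phi_cdf : std_normal_cdf Phi).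

(** A Taylor expansion in r = sqrt x around 1. The linear term is written in r^2 - 1 = x - 1, so
    that it has mean zero later. *)
Lemma std_normal_cdf_sqrt_quad x y : 0 <= x ->
  `|Phi (y * Num.sqrt x) - Phi y - y * phi y / 2 * (x - 1)| <= 2 * (x - 1) ^+ 2.
Proof.
move=> x0; rewrite -{2 3}(sqr_sqrtr x0); have := sqrtr_ge0 x.
move: (Num.sqrt x) => r {x x0} r0.
(* For r <= 3/5 the left side is at most 1/2 + 1/4, below 2 (1 - 9/25)^2. *)
have [r_small|r_big] := leP r (3 / 5).
  have h : `|Phi (y * r) - Phi y| <= 2^-1.
    have Phi0 := std_normal_cdf0 Phi_cdf.
    have [y0|y0] := leP 0 y.
      have h1 : 0 <= y * r by rewrite mulr_ge0.
      have := std_normal_cdf_ndecr Phi_cdf y0; have := std_normal_cdf_ndecr Phi_cdf h1.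
      have := std_normal_cdf_le1 Phi_cdf y; have := std_normal_cdf_le1 Phi_cdf (y * r).
      by rewrite Phi0 ler_norml; lra.
    have h1 : y * r <= 0 by rewrite mulr_le0_ge0// ltW.
    have := std_normal_cdf_ndecr Phi_cdf (ltW y0).
    have := std_normal_cdf_ndecr Phi_cdf h1.
    have := std_normal_cdf_ge0 Phi_cdf y; have := std_normal_cdf_ge0 Phi_cdf (y * r).
    by rewrite Phi0 ler_norml; lra.
  have h2 : `|y * phi y / 2 * (r ^+ 2 - 1)| <= 4^-1.
    rewrite normrM [X in X * _]normrM; have := gauss_density_mul_le y.
    have : `|r ^+ 2 - 1| <= 1 by rewrite ler_norml; apply/andP; split; nra.
    rewrite (@ger0_norm _ 2^-1)//.
    have := normr_ge0 (r ^+ 2 - 1); have := normr_ge0 (y * phi y); nra.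
  apply: (le_trans (ler_normB _ _)); apply: (le_trans (lerD h h2)); nra.
pose e s := y * phi (y * s) - s * (y * phi y).
have dphi s : is_derive s 1 (fun t => phi (y * t)) (- (y * s * phi (y * s)) * y).
  apply: (@is_derive1_comp R phi (fun t => y * t)).
    exact: is_derive_gauss_density.
  by apply: is_derive_eq; rewrite /GRing.scale/= mulr1.
have de s : is_derive s 1 e (- (y ^+ 3 * s * phi (y * s)) - y * phi y).
  by have ? := dphi s; apply: is_derive_eq; rewrite /GRing.scale/=; ring.
(* The first term is the cube bound divided by s^2, at most (3/2) (25/9); with the 1/2 from y phi(y)
   the sum is below 5. *)
have de_le s : 3 / 5 <= s -> `|- (y ^+ 3 * s * phi (y * s)) - y * phi y| <= 5.
  move=> s1; apply: (le_trans (ler_normB _ _)); rewrite normrN.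
  have := gauss_density_mul_le y; have := gauss_density_cube_le (y * s).
  have -> : (y * s) ^+ 3 * phi (y * s) = s ^+ 2 * (y ^+ 3 * s * phi (y * s)) by ring.
  rewrite normrM ger0_norm ?sqr_ge0//.
  have := normr_ge0 (y ^+ 3 * s * phi (y * s)); nra.
have e1 : e 1 = 0 by rewrite /e mulr1 mul1r subrr.
have e_le s : 3 / 5 <= s -> `|e s| <= 5 * `|s - 1|.
  move=> s1.
  have ce : continuous e by move=> t;
    apply/differentiable_continuous/derivable1_diffP; have [] := de t.
  have [s2|s2] := leP 1 s.
    have [|c cs] := @MVT_segment R e (fun s => - (y ^+ 3 * s * phi (y * s)) - y *
      phi y) 1 s s2.
      exact: continuous_subspaceT.
    rewrite e1 subr0 => ->; rewrite normrM ler_wpM2r// de_le//.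
    by move: cs; rewrite in_itv/= => /andP[]; lra.
  have [|c cs] := @MVT_segment R e (fun s => - (y ^+ 3 * s * phi (y * s)) - y *
    phi y) s 1 (ltW s2).
    exact: continuous_subspaceT.
  rewrite e1 sub0r => es; rewrite -normrN es normrM (distrC s 1) ler_wpM2r// de_le//.
  by move: cs; rewrite in_itv/= => /andP[]; lra.
pose g s := Phi (y * s) - Phi y - y * phi y / 2 * (s ^+ 2 - 1).
have dg s : is_derive s 1 g (e s).
  have h : is_derive s 1 (fun t => Phi (y * t)) (phi (y * s) * y).
    apply: (@is_derive1_comp R Phi (fun t => y * t)).
      by have [] := Phi_cdf.
    by apply: is_derive_eq; rewrite /GRing.scale/= mulr1.
  by apply: is_derive_eq; rewrite /GRing.scale/= /e; field.
have g1 : g 1 = 0 by rewrite /g mulr1; ring.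
rewrite -/(g r).
(* Taking eps = 1 and eps = -1 gives both inequalities. The sign of the derivative is that of s - 1
   because 5 <= 8 s (s + 1) for s >= 3/5. *)
have dq (eps : R) s : is_derive s 1 (fun t => 2 * (t ^+ 2 - 1) ^+ 2 + eps * g t)
    (8 * s * (s ^+ 2 - 1) + eps * e s).
  by have ? := dg s; apply: is_derive_eq; rewrite /GRing.scale/=; ring.
suff H (eps : R) : `|eps| = 1 -> 0 <= 2 * (r ^+ 2 - 1) ^+ 2 + eps * g r.
  have := H 1 (normr1 _); have := H (-1); rewrite normrN1 => /(_ erefl).
  by rewrite ler_norml; lra.
move=> eps1.
have e_eps s : 3 / 5 <= s -> `|eps * e s| <= 8 * s * (s + 1) * `|s - 1|.
  move=> s1; rewrite normrM eps1 mul1r; apply: le_trans (e_le s s1) _.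
  by rewrite ler_wpM2r//; nra.
have q1 : 0 = 2 * (1 ^+ 2 - 1) ^+ 2 + eps * g 1 by rewrite g1; ring.
have [r1|r1] := leP 1 r; rewrite q1.
  apply: (is_derive_ge0_le r1 (fun s _ => dq eps s)) => s /andP[s1 _].
  have := e_eps s;
    rewrite (@ger0_norm _ (s - 1)) ?subr_ge0// ler_norml => /(_ _)/andP[|h _];
      first lra.
  by move: h; nra.
rewrite -lerN2.
apply: (@is_derive_ge0_le _ (fun t => - (2 * (t ^+ 2 - 1) ^+ 2 + eps * g t))
  (fun s => - (8 * s * (s ^+ 2 - 1) + eps * e s)) _ _ (ltW r1)) => s.
move=> /andP[s1 s2].
have := e_eps s;
  rewrite (distrC s 1) (@ger0_norm _ (1 - s)) ?subr_ge0// ler_norml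
    => /(_ _)/andP[|_ h]; first lra.
by move: h; nra.
Qed.

End random_sample_size.

(** * Random subsets of a finite set *)

Section finite_random_set.
Context {R : realType} {I : finType}.
Implicit Types (A G J K : {set I}) (r : R).
Local Open Scope set_scope.
Local Open Scope ring_scope.

Lemma disjoint_setUl (A B C : {set I}) :
  [disjoint A :|: B & C] = [disjoint A & C] && [disjoint B & C].
Proof. by rewrite !finset.disjoints_subset finset.subUset. Qed.

Lemma prod_setU (A B : {set I}) (F : I -> R) : [disjoint A & B] ->
  \prod_(s in A :|: B) F s = \prod_(s in A) F s * \prod_(s in B) F s.
Proof. by move=> AB; rewrite -bigU//; apply: eq_bigl => s; rewrite !inE. Qed.

(** Identifies the recursive mean with the law of the size of a random subset: subsets avoiding or
    containing a chosen element a are the two outcomes of one trial. *)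
Lemma sum_subsets_binomial_mean r A (u : nat -> R) :
  \sum_(J : {set I} | J \subset A) r ^+ #|J| * (1 - r) ^+ #|A :\: J| * u #|J| =
  binomial_mean r #|A| u.
Proof.
elim: {A}#|A| {-2}A (erefl #|A|) u => [|m IH] A Am u.
  have -> : A = finset.set0 by apply/eqP; rewrite -cards_eq0 Am.
  rewrite (eq_bigl (pred1 (finset.set0 : {set I}))).
    by rewrite big_pred1_eq finset.set0D cards0 !expr0 !mul1r.
  by move=> J; rewrite finset.subset0.
have [a aA] : exists a, a \in A by apply/finset.set0Pn; rewrite -card_gt0 Am.
have A'm : #|A :\ a| = m by move: Am; rewrite (cardsD1 a A) aA => -[].
rewrite Am /= -[X in binomial_mean r X]A'm -(IH _ A'm) (bigID (fun J : {set I} =>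
  a \in J)) /= addrC.
under [in RHS]eq_bigr do rewrite mulrDr.
rewrite big_split/=; congr (_ + _).
  apply: eq_big => [J|J /andP[JA aJ]]; first by rewrite finset.subsetD1.
  have -> : #|A :\: J| = #|(A :\ a) :\: J|.+1.
    by rewrite (cardsD1 a) !inE aA aJ/= add1n; congr (#|pred_of_set _|.+1);
      apply/setP => x; rewrite !inE; case: (x == a); case: (x \in J); case: (x \in A).
  by rewrite exprS; ring.
rewrite (reindex_onto (fun J => a |: J) (fun J => J :\ a))/=; last first.
  by move=> J /andP[_ aJ]; rewrite finset.setD1K.
apply: eq_big => [J|J /andP[/andP[_ _] /eqP aJ]].
  rewrite !inE eqxx/= andbT finset.subUset finset.sub1set aA/= finset.subsetD1.
  congr (_ && _); apply/eqP/idP => [<-|aJ]; first by rewrite !inE eqxx.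
  by rewrite finset.setU1K.
have aNJ : a \notin J by rewrite -aJ !inE eqxx.
rewrite cardsU1 aNJ/= add1n exprS.
have -> : A :\: (a |: J) = (A :\ a) :\: J by rewrite finset.setDDl.
ring.
Qed.

Context (Omega : {set I}) (pH : {set I} -> R) (pr : I -> R).

Definition expect (F : {set I} -> R) := \sum_(h : {set I}) pH h * F h.

Context (pH_ge0 : forall h, 0 <= pH h) (pH1 : \sum_h pH h = 1)
  (pH_indep : forall J, J \subset Omega ->
     expect (fun h => (J \subset h)%:R) = \prod_(s in J) pr s).

Lemma expect_le F1 F2 : (forall h, pH h != 0 -> F1 h <= F2 h) -> expect F1 <= expect F2.
Proof.
move=> F12; apply: ler_sum => h _; have [->|h0] := eqVneq (pH h) 0;
  first by rewrite !mul0r.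
by rewrite ler_wpM2l ?F12.
Qed.

Lemma expect_cst a : expect (fun=> a) = a.
Proof. by rewrite /expect -mulr_suml pH1 mul1r. Qed.

Lemma expectD F1 F2 : expect (fun h => F1 h + F2 h) = expect F1 + expect F2.
Proof. by rewrite -big_split; apply: eq_bigr => h _; rewrite mulrDr. Qed.

Lemma expectZ a F : expect (fun h => a * F h) = a * expect F.
Proof. by rewrite mulr_sumr; apply: eq_bigr => h _; rewrite mulrCA. Qed.

Lemma expectB F1 F2 : expect (fun h => F1 h - F2 h) = expect F1 - expect F2.
Proof.
rewrite -mulN1r -expectZ -expectD; apply: eq_bigr => h _; congr (_ * _); ring.
Qed.

Lemma expect_sum (X : finType) (Q : pred X) (F : X -> {set I} -> R) :
  expect (fun h => \sum_(x | Q x) F x h) = \sum_(x | Q x) expect (F x).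
Proof. by rewrite exchange_big; apply: eq_bigr => h _; rewrite mulr_sumr. Qed.

Lemma expect_norm_le F : `|expect F| <= expect (fun h => `|F h|).
Proof.
apply: le_trans (ler_norm_sum _ _ _) _; apply: ler_sum => h _.
by rewrite normrM ger0_norm.
Qed.

(** Induction on K: the indicator that k is absent is 1 minus the indicator that k is present. *)
Lemma expect_inclusion_exclusion J K : J \subset Omega -> K \subset Omega ->
  [disjoint J & K] -> expect (fun h => ((J \subset h) && (K \subset ~: h))%:R) =
  \prod_(s in J) pr s * \prod_(s in K) (1 - pr s).
Proof.
elim: {K}#|K| {-2}K (erefl #|K|) J => [|m IH] K Km J JO KO JK.
  have -> : K = finset.set0 by apply/eqP; rewrite -cards_eq0 Km.
  rewrite big_set0 mulr1 -pH_indep//; apply: eq_bigr => h _.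
  by rewrite finset.sub0set andbT.
have [k kK] : exists k, k \in K by apply/finset.set0Pn; rewrite -card_gt0 Km.
have K'm : #|K :\ k| = m by move: Km; rewrite (cardsD1 k K) kK => -[].
have K'O : K :\ k \subset Omega
  by rewrite (fintype.subset_trans _ KO)// finset.subD1set.
have kJ : k \notin J by move: JK; rewrite disjoint_sym => /disjointFr ->.
have JK' : [disjoint J & K :\ k].
  by apply: disjointWr JK; rewrite finset.subD1set.
have kJK' : [disjoint k |: J & K :\ k].
  by rewrite disjoint_setUl disjoints1 JK' !inE eqxx.
have kJO : k |: J \subset Omega
  by rewrite finset.subUset finset.sub1set (fintype.subsetP KO).
have -> : expect (fun h => ((J \subset h) && (K \subset ~: h))%:R) =
    expect (fun h => ((J \subset h) && (K :\ k \subset ~: h))%:R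
       - ((k |: J \subset h) && (K :\ k \subset ~: h))%:R).
  apply: eq_bigr => h _; congr (_ * _).
  rewrite -{1}(finset.setD1K kK) !finset.subUset !finset.sub1set inE.
  by case: (k \in h); case: (J \subset h); case: (_ \subset ~: h);
    rewrite /= ?subrr ?subr0.
rewrite expectB !IH// big_setU1//= (big_setD1 k kK)/=; ring.
Qed.

Context (L U : {set I}) (LO : L \subset Omega) (UO : U \subset Omega)
  (LU : [disjoint L & U]) (r : R) (prU : forall s, s \in U -> pr s = r).
Context (A : {set I} -> {set I}) (AU : forall G, A G \subset U).

(** Given the trace G of h on L, the set A(G) is fixed and lies in U, disjoint from L. Its elements
    are then present independently with probability r, so their number is binomial. *)
Lemma expect_cond_binomial (u : {set I} -> nat -> R) :
  expect (fun h => u (h :&: L) #|h :&: A (h :&: L)|) =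
  expect (fun h => binomial_mean r #|A (h :&: L)| (u (h :&: L))).
Proof.
have splitL (F : {set I} -> {set I} -> R) : expect (fun h => F (h :&: L) h) =
    \sum_(G : {set I} | G \subset L) expect (fun h => (h :&: L == G)%:R * F G h).
  rewrite -expect_sum; apply: eq_bigr => h _; congr (_ * _).
  rewrite (bigD1 (h :&: L)) ?finset.subsetIr//= eqxx mul1r big1 ?addr0// => G
    /andP[_ hG].
  by rewrite eq_sym (negbTE hG) mul0r.
rewrite (splitL (fun G h => u G #|h :&: A G|)).
rewrite (splitL (fun G h => binomial_mean r #|A G| (u G))).
apply: eq_bigr => G GL.
have AO : A G \subset Omega by exact: fintype.subset_trans (AU G) UO.
(* A prescribed trace on K is a pattern of inclusions and exclusions, to which
   [expect_inclusion_exclusion] applies. *)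
have atom (K J : {set I}) h : J \subset K ->
    (h :&: K == J) = (J \subset h) && (K :\: J \subset ~: h).
  move=> JK; apply/eqP/andP => [<-|[Jh KJh]].
    split; first exact: finset.subsetIl.
    by apply/fintype.subsetP => x; rewrite !inE => /andP[+ xK]; rewrite xK andbT.
  apply/setP => x; rewrite !inE; have [xJ|xJ] := boolP (x \in J).
    by rewrite (fintype.subsetP Jh _ xJ) (fintype.subsetP JK _ xJ).
  apply/negP => /andP[xh xK]; have /(fintype.subsetP KJh) : x \in K :\: J
    by rewrite inE xJ.
  by rewrite inE xh.
have disj (B C : {set I}) : B \subset L -> C \subset U -> [disjoint B & C].
  by move=> BL CU; apply: disjointWl BL _; apply: disjointWr CU _.
have disjD (B C : {set I}) : [disjoint B & C :\: B].
  by rewrite disjoint_sym -finset.setI_eq0; apply/eqP/setP => x; rewrite !inE;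
    case: (x \in B) => /=; rewrite ?andbF.
have EG : expect (fun h => (h :&: L == G)%:R) =
    \prod_(s in G) pr s * \prod_(s in L :\: G) (1 - pr s).
  rewrite -expect_inclusion_exclusion//.
  - by apply: eq_bigr => h _; rewrite atom.
  - exact: fintype.subset_trans GL LO.
  - by rewrite (fintype.subset_trans (finset.subsetDl _ _)).
have -> : expect (fun h => (h :&: L == G)%:R * binomial_mean r #|A G| (u G)) =
    binomial_mean r #|A G| (u G) * expect (fun h => (h :&: L == G)%:R).
  by rewrite -expectZ; apply: eq_bigr => h _; rewrite [X in _ * X]mulrC.
rewrite -sum_subsets_binomial_mean mulr_suml.
have -> : expect (fun h => (h :&: L == G)%:R * u G #|h :&: A G|) =
    expect (fun h => \sum_(J : {set I} | J \subset A G)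
      u G #|J| * ((h :&: L == G) && (h :&: A G == J))%:R).
  apply: eq_bigr => h _; congr (_ * _).
  rewrite (bigD1 (h :&: A G)) ?finset.subsetIr//= eqxx andbT big1 ?addr0.
    by rewrite mulrC.
  by move=> J /andP[_ hJ]; rewrite [h :&: A G == J]eq_sym (negbTE hJ) andbF mulr0.
rewrite expect_sum; apply: eq_bigr => J JA; rewrite expectZ mulrC [in RHS]mulrAC;
  congr (_ * _).
have -> : expect (fun h => ((h :&: L == G) && (h :&: A G == J))%:R) =
    expect (fun h => ((G :|: J \subset h) && ((L :\: G) :|: (A G :\: J) \subset
      ~: h))%:R).
  apply: eq_bigr => h _; rewrite !atom// !finset.subUset.
  by case: (G \subset h); case: (J \subset h); rewrite /= ?andbF.
have GJ := disj _ _ GL (fintype.subset_trans JA (AU G)).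
have LGU : L :\: G \subset L by exact: finset.subsetDl.
have AJU : A G :\: J \subset U by rewrite (fintype.subset_trans (finset.subsetDl _ _)).
rewrite expect_inclusion_exclusion; first last.
- have JU := fintype.subset_trans JA (AU G).
  rewrite disjoint_setUl !(disjoint_sym _ (_ :|: _)) !disjoint_setUl.
  by rewrite !(disjoint_sym _ G) !(disjoint_sym _ J) !disjD disj//= disjoint_sym disj.
- by rewrite finset.subUset (fintype.subset_trans LGU LO) (fintype.subset_trans AJU UO).
- by rewrite finset.subUset (fintype.subset_trans GL LO) (fintype.subset_trans JA AO).
have dLA := disj _ _ LGU AJU.
rewrite EG !prod_setU//.
have -> : \prod_(s in J) pr s = r ^+ #|J|.
  rewrite -prodr_const; apply: eq_bigr => s sJ; apply: prU.
  exact: (fintype.subsetP (fintype.subset_trans JA (AU G))).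
have -> : \prod_(s in A G :\: J) (1 - pr s) = (1 - r) ^+ #|A G :\: J|.
  rewrite -prodr_const; apply: eq_bigr => s sJ; rewrite prU//.
  exact: (fintype.subsetP AJU).
ring.
Qed.

End finite_random_set.

(** * The number of hollow simplices *)

Section hollow_count.
Context {R : realType} (n i : nat) (p : nat -> R).
Local Notation V := {set 'I_n}.
Implicit Types (s t : V) (h G : {set V}).
Local Open Scope set_scope.
Local Open Scope ring_scope.

(** Singletons are left out because they are always present; only random sets remain. *)
Definition boundary s : {set V} := [set t : V | (2 <= #|t|)%N && (t \proper s)]%SET.

Definition hollow_over G : {set V} :=
  [set s : V | (#|s| == i.+1) && (boundary s \subset G)]%SET.

Definition lower_sets : {set V} := [set t : V | (2 <= #|t| <= i)%N]%SET.

Definition top_sets : {set V} := [set s : V | #|s| == i.+1]%SET.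

Lemma boundary_lower s : #|s| = i.+1 -> boundary s \subset lower_sets.
Proof.
move=> si; apply/fintype.subsetP => t; rewrite !inE => /andP[-> /proper_card].
by rewrite si ltnS.
Qed.

(** Hollow simplices are determined by the sets of at most i vertices, the part of the hypergraph on
    which one conditions. *)
Lemma hollow_over_lower h :
  hollow_over (h :&: lower_sets) = hollow_over h.
Proof.
apply/setP => s; rewrite !inE; case: eqP => //= si.
by rewrite finset.subsetI boundary_lower ?andbT.
Qed.

Lemma hollow_faces_subset (h : hypergraph n) s : (s \in hollow_faces h i) =
  (#|s| == i.+1) && [forall t : V, (t != finset.set0) && (t \proper s) ==> (t \in
    (h : {set V}))].
Proof.
rewrite inE; congr (_ && _).
apply/'forall_implyP/'forall_implyP => H t /andP[t0 ts].
  have := H t; rewrite t0 ts inE t0 /= => /(_ isT) /'forall_implyP; apply.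
  by rewrite t0/=.
rewrite inE t0; apply/'forall_implyP => t' /andP[t'0 t't]; apply: H.
by rewrite t'0 (sub_proper_trans t't).
Qed.

Lemma hollow_facesE (h : hypergraph n) :
  (forall v, [set v]%SET \in (h : {set V})) -> hollow_faces h i = hollow_over h.
Proof.
move=> h1; apply/setP => s; rewrite hollow_faces_subset inE; congr (_ && _).
apply/'forall_implyP/fintype.subsetP => H t.
  rewrite inE => /andP[t2 ts]; apply: H; rewrite ts andbT.
  by rewrite -card_gt0 (leq_trans _ t2).
move=> /andP[t0 ts]; have [t1|t2] := leqP #|t| 1.
  have /cards1P[v ->] : #|t| == 1%N by rewrite eqn_leq t1 card_gt0.
  exact: h1.
by apply: H; rewrite inE t2.
Qed.

(** This makes the estimator a proportion of successes among the hollow simplices. *)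
Lemma facesE (h : hypergraph n) : faces h i = (h : {set V}) :&: hollow_faces h i.
Proof.
apply/setP => s; rewrite finset.in_setI hollow_faces_subset !inE.
case: (#|s| =P i.+1) => [si|]; rewrite ?andbF// andbT/=.
have s0 : s != finset.set0 by rewrite -card_gt0 si.
rewrite s0/=; apply/'forall_implyP/andP => [H|[sh H] t /andP[t0]].
  split; first by apply: H; rewrite s0/=.
  apply/'forall_implyP => t /andP[t0 ts]; apply: H.
  by rewrite t0 (proper_sub ts).
rewrite subEproper => /predU1P[->//|ts].
by move/'forall_implyP : H; apply; rewrite t0.
Qed.

Local Notation prob := (fun s : V => p #|s|.-1).

(** Groups the boundary by dimension: s has C(i+1, j+1) subsets of j + 1 vertices. *)
Lemma prod_boundary s : (1 <= i)%N -> #|s| = i.+1 ->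
  \prod_(t in boundary s) prob t = hollow_prob p i.
Proof.
case: i => // i' _ si; rewrite /hollow_prob big_geq_mkord/=.
rewrite (partition_big (fun t : V => inord #|t|.-1 : 'I_i'.+1) (fun j => 0 < j)%N)/=.
  apply: eq_bigr => j j0; rewrite -si -(cards_draws s j.+1).
  rewrite (eq_bigr (fun=> p j)).
    rewrite prodr_const; congr (_ ^+ _); apply: eq_card => t.
    rewrite unfold_in !inE.
    apply/idP/idP => [/andP[/andP[t2 ts] /eqP jt]|/andP[ts /eqP tj]].
      rewrite (proper_sub ts)/=; have := proper_card ts; rewrite si ltnS => ti.
      by rewrite -jt inordK prednK// (leq_trans _ t2).
    rewrite tj ltnS j0/= properEcard ts si tj ltnS ltn_ord/=.
    by apply/eqP/val_inj; rewrite /= inordK.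
  move=> t /andP[]; rewrite inE => /andP[t2 /proper_card];
    rewrite si ltnS => ti /eqP <-.
  by rewrite inordK// prednK// (leq_trans _ t2).
move=> t; rewrite inE => /andP[t2 /proper_card]; rewrite si ltnS => ti.
by rewrite inordK ?prednK// ?(leq_trans _ t2)//; case: #|t| t2 => [|[]].
Qed.

Lemma disjoint_boundary s t : (#|s :&: t| < 2)%N -> [disjoint boundary s & boundary t].
Proof.
move=> st; rewrite -finset.setI_eq0; apply/eqP/setP => a; rewrite !inE.
apply/negP => /andP[/andP[a2 /proper_sub as_] /andP[_ /proper_sub at_]].
move: st; rewrite ltnNge => /negP; apply; apply: leq_trans a2 _.
by apply: subset_leq_card; rewrite finset.subsetI as_.
Qed.

(** Removing e gives a bijection with the (i-1)-subsets of its complement. *)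
Lemma card_supersets (e : V) : #|e| = 2%N -> (1 <= i)%N ->
  #|[set s : V | (#|s| == i.+1) && (e \subset s)]%SET| = 'C(n.-2, i.-1).
Proof.
move=> e2 i1.
have ce : #|~: e| = n.-2 by have := cardsC e;
  rewrite card_ord e2 => /(congr1 predn)/(congr1 predn).
rewrite -ce -cards_draws.
rewrite -[RHS](card_in_imset (f := fun s : V => s :|: e)); last first.
  move=> s t; rewrite !inE => /andP[se _] /andP[te _] /setP st; apply/setP => x.
  have := st x; rewrite !inE; have [xe _|] := boolP (x \in e); last by rewrite !orbF.
  have /negbTE -> : x \notin s by apply: contraL xe => /(fintype.subsetP se);
    rewrite inE.
  by apply/esym/negbTE; apply: contraL xe => /(fintype.subsetP te); rewrite inE.
apply: eq_card => s; rewrite !inE; apply/andP/imsetP => [[/eqP si es]|[t]].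
  exists (s :\: e).
    rewrite !inE finset.subsetDr /= cardsD (finset.setIidPr es) si e2.
    by rewrite subn2; case: i i1.
  by apply/setP => x; rewrite !inE; have [/(fintype.subsetP es) ->|] := boolP (x \in e);
    rewrite ?orbT ?orbF.
rewrite !inE => /andP[te /eqP ti] ->; rewrite finset.subsetUr; split=> //.
rewrite cardsU e2 ti; have -> : t :&: e = finset.set0.
  by apply/eqP; rewrite finset.setI_eq0 finset.disjoints_subset.
by rewrite cards0 subn0 addn2; case: i i1.
Qed.

Context (pH : {set V} -> R) (pH_ge0 : forall h, 0 <= pH h) (pH1 : \sum_h pH h = 1)
  (pH_indep : forall J : {set V}, J \subset [set s : V | (2 <= #|s|)%N]%SET ->
     expect pH (fun h => (J \subset h)%:R) = \prod_(s in J) prob s).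
Context (i_ge1 : (1 <= i)%N).

Local Notation P := (hollow_prob p i).
Local Notation E := (expect pH).
Let N h : R := #|hollow_over h|%:R.

Let NE h : N h = \sum_(s in top_sets) (boundary s \subset h)%:R.
Proof.
rewrite /N -sum1_card natr_sum big_mkcond [RHS]big_mkcond.
by apply: eq_bigr => s _; rewrite !inE; case: eqP => //= _; case: (_ \subset _).
Qed.

Let card_top : #|top_sets| = 'C(n, i.+1).
Proof. by rewrite card_draws card_ord. Qed.

Let boundary_ge2 s : boundary s \subset [set s : V | (2 <= #|s|)%N]%SET.
Proof. by apply/fintype.subsetP => t; rewrite !inE => /andP[]. Qed.

Lemma expect_hollow_count : E N = 'C(n, i.+1)%:R * P.
Proof.
have -> : E N = E (fun h => \sum_(s in top_sets) (boundary s \subset h)%:R).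
  by apply: eq_bigr => h _; rewrite NE.
rewrite expect_sum -card_top mulr_natl -sumr_const; apply: eq_bigr => s.
by rewrite inE => /eqP si; rewrite pH_indep// prod_boundary.
Qed.

(** Two sets with fewer than two common vertices have disjoint boundaries and contribute P^2. Any
    other pair contributes at most P and is charged to the common vertex pairs e, each of which lies
    in C(n-2, i-1)^2 pairs of sets. *)
Lemma expect_hollow_count2 : 0 <= P ->
  E (fun h => N h ^+ 2) <=
  ('C(n, i.+1)%:R * P) ^+ 2 + 'C(n, 2)%:R * 'C(n.-2, i.-1)%:R ^+ 2 * P.
Proof.
move=> P0.
have -> : E (fun h => N h ^+ 2) = E (fun h => \sum_(s in top_sets) \sum_(t in top_sets)
    ((boundary s :|: boundary t) \subset h)%:R).
  apply: eq_bigr => h _; congr (_ * _); rewrite expr2 NE mulr_suml.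
  apply: eq_bigr => s _; rewrite mulr_sumr; apply: eq_bigr => t _.
  by rewrite finset.subUset -natrM mulnb.
rewrite expect_sum; under eq_bigr do rewrite expect_sum.
apply: (@le_trans _ _ (\sum_(s in top_sets) \sum_(t in top_sets)
   (P ^+ 2 + \sum_(e : V | #|e| == 2%N) (e \subset s)%:R * (e \subset t)%:R * P))).
  apply: ler_sum => s; rewrite inE => /eqP si; apply: ler_sum => t;
    rewrite inE => /eqP ti.
  have sum0 (Q : pred V) : 0 <= \sum_(e : V | Q e) (e \subset s)%:R * (e \subset
    t)%:R * P.
    by apply: sumr_ge0 => e _; rewrite !mulr_ge0.
  have [st|st] := ltnP #|s :&: t| 2.
    rewrite pH_indep ?finset.subUset ?boundary_ge2// prod_setU ?disjoint_boundary//.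
    by rewrite !prod_boundary// -expr2 lerDl.
  have [e /andP[/eqP e2 est]] : exists e : V, (#|e| == 2%N) && (e \subset s :&: t).
    have : (0 < #|[set e : V | e \subset s :&: t & #|e| == 2%N]%SET|)%N.
      by rewrite cards_draws bin_gt0.
    by rewrite card_gt0 => /finset.set0Pn[e]; rewrite inE andbC => ?; exists e.
  move: est; rewrite finset.subsetI => /andP[es et].
  rewrite (bigD1 e) ?e2//= es et !mul1r addrCA; apply: ler_wpDr.
    by rewrite addr_ge0 ?sqr_ge0.
  rewrite -(prod_boundary i_ge1 si) -pH_indep//; apply: expect_le => // h _.
  by rewrite finset.subUset; case: (boundary s \subset h) => //=;
    case: (boundary t \subset h).
under eq_bigr do rewrite big_split/= sumr_const.
rewrite big_split/= sumr_const card_top; apply: lerD.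
  have sqE (a : R) (k : nat) : a ^+ 2 *+ k *+ k = (k%:R * a) ^+ 2.
    by rewrite -mulr_natl -(mulr_natl (a ^+ 2)); ring.
  by rewrite sqE.
under eq_bigr do rewrite exchange_big/=.
rewrite exchange_big/=.
rewrite (eq_bigr (fun=> 'C(n.-2, i.-1)%:R ^+ 2 * P)).
  have card2 : #|[pred e : V | #|e| == 2%N]| = 'C(n, 2).
    rewrite -[X in 'C(X, _)](card_ord n) -card_draws.
    by apply: eq_card => e; rewrite !inE.
  by rewrite sumr_const card2 -mulrA mulr_natl.
move=> e /eqP e2.
have cE : \sum_(s in top_sets) (e \subset s)%:R = 'C(n.-2, i.-1)%:R :> R.
  rewrite -(card_supersets e2 i_ge1) -sum1_card natr_sum big_mkcond [RHS]big_mkcond.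
  by apply: eq_bigr => s _; rewrite !inE; case: eqP => //= _; case: (_ \subset _).
rewrite expr2 -{1}cE !mulr_suml; apply: eq_bigr => s _.
by rewrite -cE mulr_sumr mulr_suml.
Qed.

Lemma hollow_count_variance : 0 < P -> (i < n)%N ->
  E (fun h => (N h / ('C(n, i.+1)%:R * P) - 1) ^+ 2) <=
  (i%:R * i.+1%:R) ^+ 2 / (2 * n%:R * (n%:R - 1) * P).
Proof.
move=> P0 i_n; set mu := _ * P.
have C0 : 0 < 'C(n, i.+1)%:R :> R by rewrite ltr0n bin_gt0.
have mu0 : 0 < mu by rewrite mulr_gt0.
have n0 : 0 < n%:R :> R by rewrite ltr0n (leq_trans _ i_n).
have n1 : 0 < n%:R - 1 :> R by rewrite subr_gt0 ltr1n (leq_trans _ i_n).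
have -> : E (fun h => (N h / mu - 1) ^+ 2) =
    E (fun h => mu ^- 2 * N h ^+ 2 + ((- 2 / mu) * N h + 1)).
  by apply: eq_bigr => h _; congr (_ * _); field; exact: lt0r_neq0.
rewrite !expectD !expectZ expect_cst// expect_hollow_count -/mu.
have -> : - 2 / mu * mu + 1 = -1 by rewrite divfK ?lt0r_neq0//; ring.
rewrite lerBlDr ler_pdivrMl ?exprn_gt0//.
apply: le_trans (expect_hollow_count2 (ltW P0)) _.
(* Both sides count (i+1)-sets with an ordered pair of distinct elements; this turns the
   second-moment bound into a multiple of the squared mean. *)
have binE : n%:R * (n%:R - 1) * 'C(n.-2, i.-1)%:R = i%:R * i.+1%:R * 'C(n,
  i.+1)%:R :> R.
  have -> : n%:R - 1 = n.-1%:R :> R by case: n i_n => // m _; rewrite -natr1 addrK.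
  rewrite -!natrM; congr _%:R; rewrite -mulnA.
  have /= := mul_bin_diag n.-1 i.-1; rewrite prednK// => ->.
  by rewrite mulnCA mul_bin_diag mulnA.
have bin2E : 'C(n, 2)%:R = n%:R * (n%:R - 1) / 2 :> R.
  have -> : n%:R - 1 = n.-1%:R :> R by case: n i_n => // m _; rewrite -natr1 addrK.
  have := mul_bin_diag n 1; rewrite bin1 => /(congr1 (fun k => k%:R : R)).
  by rewrite !natrM => ->; field.
have -> : 'C(n.-2, i.-1)%:R = i%:R * i.+1%:R * 'C(n, i.+1)%:R / (n%:R * (n%:R -
  1)) :> R.
  by rewrite -binE; field; rewrite !lt0r_neq0.
rewrite bin2E /mu; move: 'C(n, i.+1)%:R P C0 P0 => c q c0 q0.
rewrite le_eqVlt; apply/orP; left; apply/eqP; field.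
by rewrite !lt0r_neq0.
Qed.

End hollow_count.

(** * The law of the normalized estimator *)

Section normalized_mle_cdf.
Context {R : realType} (n i : nat) (p : nat -> R).
Local Notation V := {set 'I_n}.
Local Notation P := (hollow_prob p i).
Local Notation q := (1 - p i).
Context (Phi : R -> R) (Phi_cdf : std_normal_cdf Phi).
Context (pH : {set V} -> R) (pH_ge0 : forall h, 0 <= pH h) (pH1 : \sum_h pH h = 1)
  (pH_indep : forall J : {set V}, J \subset [set s : V | (2 <= #|s|)%N]%SET ->
     expect pH (fun h => (J \subset h)%:R) = \prod_(s in J) p #|s|.-1)
  (pH_single : forall h, pH h != 0 -> forall v, [set v]%SET \in h).
Context (i_ge1 : (1 <= i)%N) (i_n : (i < n)%N) (pi01 : 0 < p i < 1) (P_gt0 : 0 < P).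
Local Notation E := (expect pH).
Local Notation be_const := ((Num.sqrt 10 + 3) / (3 * Num.sqrt (@pi R))).

Let mu : R := 'C(n, i.+1)%:R * P.
Let N (h : {set V}) := #|hollow_over i h|.
Let u (x : R) (m k : nat) : R :=
  (Num.sqrt mu * ((if m == 0%N then 0 else k%:R / m%:R) - p i) <= x)%R%:R.

Let mu_gt0 : 0 < mu. Proof. by rewrite mulr_gt0// ltr0n bin_gt0. Qed.

(** Conditions on the sets of at most i vertices. Hypergraphs of zero mass are discarded first,
    since singletons are known to be present only on the support. *)
Let cdf_mean (x : R) :
  E (fun h => (normalized_mle p i (h : hypergraph n) <= x)%R%:R) =
  E (fun h => binomial_mean (p i) (N h) (u x (N h))).
Proof.
transitivity (E (fun h => (fun G => u x (N G)) (h :&: lower_sets n i)%SET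
    #|(h :&: hollow_over i (h :&: lower_sets n i))%SET|)).
  apply: eq_bigr => h _; have [->|h0] := eqVneq (pH h) 0; first by rewrite !mul0r.
  rewrite /u /N hollow_over_lower /normalized_mle /mle facesE.
  by rewrite (hollow_facesE i (pH_single h0)).
rewrite (expect_cond_binomial pH_indep (L := lower_sets n i) (U := top_sets n i)
  _ _ _ (r := p i) _ (A := hollow_over i) _ (fun G => u x (N G))).
- by apply: eq_bigr => h _; rewrite /N hollow_over_lower.
- by apply/fintype.subsetP => s; rewrite !inE => /andP[].
- by apply/fintype.subsetP => s; rewrite !inE => /eqP ->; rewrite ltnS.
- rewrite -finset.setI_eq0; apply/eqP/setP => s; rewrite !inE.
  by case: (#|s| =P i.+1) => [->|]; rewrite ?andbF// ltnn andbF.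
- by move=> s; rewrite inE => /eqP ->.
- by move=> G; apply/fintype.subsetP => s; rewrite !inE => /andP[].
Qed.

(** The factor 4 is 2 from [inv_sqrt_le_quad] plus 2 from [std_normal_cdf_sqrt_quad]. *)
Lemma normalized_mle_cdf_close (x : R) :
  let b := be_const / Num.sqrt (mu * (p i * q)) in b <= 1 ->
  `|E (fun h => (normalized_mle p i (h : hypergraph n) <= x)%R%:R)
     - Phi (x / Num.sqrt (p i * q))| <=
  b + 4 * E (fun h => (#|hollow_over i h|%:R / mu - 1) ^+ 2).
Proof.
move=> b b1; have /andP[p0 p1] := pi01.
have q0 : 0 < q by rewrite subr_gt0.
have pq0 : 0 < p i * q by rewrite mulr_gt0.
have b0 : 0 <= b by rewrite !mulr_ge0 ?invr_ge0 ?mulr_ge0 ?addr_ge0.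
set y := x / _; pose X (h : {set V}) : R := #|hollow_over i h|%:R / mu.
have X0 h : 0 <= X h by rewrite divr_ge0// ltW.
have u01 m k : 0 <= u x m k <= 1 by rewrite /u; case: (_ <= x); rewrite ?ler01 ?lexx.
have p01 : 0 <= p i <= 1 by apply/andP; split; exact: ltW.
pose F (h : {set V}) := binomial_mean (p i) (N h) (u x (N h)).
have Fclose h : `|F h - Phi (y * Num.sqrt (X h))| <=
    b - b / 2 * (X h - 1) + 2 * (X h - 1) ^+ 2.
  apply: inv_sqrt_le_quad => //; first by rewrite b0.
    have := std_normal_cdf_ge0 Phi_cdf (y * Num.sqrt (X h)).
    have := std_normal_cdf_le1 Phi_cdf (y * Num.sqrt (X h)).
    have : 0 <= F h.
      rewrite -[0](binomial_mean_cst (p i) (N h)); apply: (binomial_mean_le p01) => k.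
      by have /andP[] := u01 (N h) k.
    have : F h <= 1.
      rewrite -[1](binomial_mean_cst (p i) (N h)); apply: (binomial_mean_le p01) => k.
      by have /andP[] := u01 (N h) k.
    by rewrite ler_norml; lra.
  (* If N = 0 then X = 0 and the premise 0 < X fails, so at least one trial may be assumed. *)
  rewrite /F /X -/(N h); case: (N h) => [|m]; first by rewrite mul0r ltxx.
  move=> _; set M : R := m.+1%:R; have M0 : 0 < M by rewrite ltr0n.
  have sM : 0 < Num.sqrt M by rewrite sqrtr_gt0.
  have smu : 0 < Num.sqrt mu by rewrite sqrtr_gt0.
  have spq : 0 < Num.sqrt (p i * q) by rewrite sqrtr_gt0.
  have sXE : Num.sqrt (M / mu) = Num.sqrt M / Num.sqrt mu.
    by rewrite sqrtrM ?sqrtrV// ltW.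
  have sME : Num.sqrt (M * p i * q) = Num.sqrt M * Num.sqrt (p i * q).
    by rewrite -mulrA sqrtrM// ltW.
  have smuE : Num.sqrt (mu * (p i * q)) = Num.sqrt mu * Num.sqrt (p i * q).
    by rewrite sqrtrM// ltW.
  have -> : b / Num.sqrt (M / mu) = be_const / Num.sqrt (M * p i * q).
    rewrite sXE sME /b smuE; move: be_const => c; field.
    by rewrite !lt0r_neq0.
  have -> : u x m.+1 = (fun k => ((k%:R - M * p i) / Num.sqrt (M * p i * q)
      <= y * Num.sqrt (M / mu))%R%:R).
    apply/funext => k; rewrite /u/= -/M; congr ((nat_of_bool _)%:R).
    rewrite sXE sME /y.
    have -> : x / Num.sqrt (p i * q) * (Num.sqrt M / Num.sqrt mu) =
      x * (Num.sqrt M / (Num.sqrt (p i * q) * Num.sqrt mu)).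
      by field; rewrite !lt0r_neq0.
    rewrite ler_pdivrMr ?mulr_gt0//.
    rewrite -[RHS](ler_pM2r (_ : 0 < Num.sqrt mu / M)) ?divr_gt0//.
    congr (_ <= _).
      by field; exact: lt0r_neq0.
    have ME : M = Num.sqrt M ^+ 2 by rewrite sqr_sqrtr// ltW.
    move: sM ME; move: (Num.sqrt M) => a a0 ->.
    by field; rewrite !lt0r_neq0.
  exact: binomial_berry_esseen.
rewrite cdf_mean.
have EX : E (fun h => X h - 1) = 0.
  rewrite expectB expect_cst//.
  have -> : E X = E (fun h => mu^-1 * #|hollow_over i h|%:R).
    by apply: eq_bigr => h _; rewrite /X [mu^-1 * _]mulrC.
  rewrite expectZ (expect_hollow_count pH_indep)//.
  by rewrite -/mu mulVf ?subrr// lt0r_neq0.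
set v := E (fun h => (X h - 1) ^+ 2).
(* Subtracting the linear term changes nothing, because X - 1 has mean zero. *)
have -> : E F - Phi y = E (fun h => F h - Phi (y * Num.sqrt (X h))) +
    (E (fun h => Phi (y * Num.sqrt (X h)) - Phi y
       - y * gauss_density y / 2 * (X h - 1))).
  rewrite !expectB expectZ EX expect_cst//; ring.
apply: le_trans (ler_normD _ _) _.
have h1 : `|E (fun h => F h - Phi (y * Num.sqrt (X h)))| <= b + 2 * v.
  apply: le_trans (expect_norm_le pH_ge0 _) _.
  apply: le_trans (expect_le pH_ge0 (fun h _ => Fclose h)) _.
  by rewrite expectD expectB !expectZ EX expect_cst// mulr0 subr0.
have h2 : `|E (fun h => Phi (y * Num.sqrt (X h)) - Phi y
       - y * gauss_density y / 2 * (X h - 1))| <= 2 * v.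
  apply: le_trans (expect_norm_le pH_ge0 _) _; rewrite -expectZ.
  by apply: expect_le => // h _; exact: std_normal_cdf_sqrt_quad.
by apply: le_trans (lerD h1 h2) _; lra.
Qed.

End normalized_mle_cdf.

(** * From the random variables to finite sums *)

Section normal_law_cdf.
Context {R : realType} {d : measure_display} {T : measurableType d}
  (Q : probability T R) (Z : {RV Q >-> R}) (v : R) (v_gt0 : 0 < v)
  (Z_normal : normal_law Q Z 0 v).
Local Open Scope classical_set_scope.
Local Open Scope ring_scope.
Let s := Num.sqrt v.
Let s_gt0 : 0 < s. Proof. by rewrite sqrtr_gt0. Qed.

Let normal_pdf_scale y : normal_pdf 0 s (s * y) * s = gauss_density y.
Proof.
rewrite normal_pdfE ?gt_eqF// /normal_peak /normal_fun /gauss_density subr0.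
have -> : s ^+ 2 * pi *+ 2 = s ^+ 2 * (2 * pi) by rewrite -mulr_natl; ring.
have -> : - (s * y) ^+ 2 / (s ^+ 2 *+ 2) = - (y ^+ 2 / 2).
  by rewrite -[s ^+ 2 *+ 2]mulr_natl; field; rewrite gt_eqF.
rewrite sqrtrM ?sqr_ge0// sqrtr_sqr ger0_norm ?ltW// invfM.
by move: (Num.sqrt (2 * pi))^-1 (expR _) => a b; field; rewrite gt_eqF.
Qed.

Lemma normal_law_std_cdf : std_normal_cdf (fun y => fine (cdf Z (s * y))).
Proof.
split.
- move=> y.
  pose F x : R := (\int[lebesgue_measure]_(t in `]-oo, x]) normal_pdf 0 s t)%R.
  have -> : (fun y => fine (cdf Z (s * y))) = (fun y => F (s * y)).
    by apply/funext => x; rewrite /cdf Z_normal.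
  have [dF F'] : derivable F (s * y) 1 /\ derive1 F (s * y) = normal_pdf 0 s (s * y).
    apply: (@continuous_FTC1 R (normal_pdf 0 s) -oo%O (s * y) (s * y + 1)).
    + by rewrite ltrDl.
    + apply: (integrableS measurableT) => //; exact: integrable_normal_pdf.
    + by rewrite ltNyr.
    + by apply: continuous_normal_pdf; rewrite gt_eqF.
  have dFs : is_derive (s * y) 1 F (normal_pdf 0 s (s * y)).
    by split; [exact: dF|rewrite -derive1E; exact: F'].
  rewrite -normal_pdf_scale.
  apply: (@is_derive1_comp R F (fun y => s * y)).
  by apply: is_derive_eq; rewrite /GRing.scale/= mulr1.
- have sNy : s * y @[y --> -oo] --> (-oo : set_system R).
    by apply: gt0_cvgMrNy => //; exact: cvg_id.
  exact: (cvg_comp (fun y => s * y) (fine \o cdf Z) sNy (fine_cvg (cvg_cdfNy0 Z))).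
- have sy : s * y @[y --> +oo] --> (+oo : set_system R).
    by apply: gt0_cvgMry => //; exact: cvg_id.
  exact: (cvg_comp (fun y => s * y) (fine \o cdf Z) sy (fine_cvg (cvg_cdfy1 Z))).
Qed.

End normal_law_cdf.

Section random_hypergraph_law.
Context {R : realType} {n : nat} {d : measure_display} {T : measurableType d}
  (P : probability T R) (p : nat -> R) (H : {RV P >-> hypergraph n}).
Local Open Scope classical_set_scope.
Local Open Scope ring_scope.
Local Notation V := {set 'I_n}.

Definition hypergraph_pmf (h : {set V}) : R := fine (P [set w | (H w : {set V}) = h]).

Lemma hypergraph_pmf_ge0 h : 0 <= hypergraph_pmf h.
Proof. by rewrite fine_ge0. Qed.

Let measurable_H (B : set (hypergraph n)) : measurable [set w | B (H w)].
Proof. by rewrite -[X in measurable X]setTI; apply: (measurable_funP H). Qed.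

(** Finite additivity along an enumeration of the hypergraphs; from here on all probabilities are
    finite sums. *)
Lemma prob_hypergraph (b : pred {set V}) :
  P [set w | b (H w)] = (expect hypergraph_pmf (fun h => (b h)%:R))%:E.
Proof.
have finP h : P [set w | (H w : {set V}) = h] = (hypergraph_pmf h)%:E.
  by rewrite fineK// fin_num_measure//; exact: (measurable_H [set h]).
have seqP (r : seq {set V}) : uniq r ->
    P [set w | (H w : {set V}) \in r] = (\sum_(h <- r) hypergraph_pmf h)%:E.
  elim: r => [_|h r IH /= /andP[hr ur]].
    by rewrite big_nil [X in P X](_ : _ = set0) ?measure0//; apply/seteqP; split.
  rewrite big_cons EFinD -IH// -finP -measureU.
  - by congr (P _); apply/seteqP; split => w /=; rewrite inE => /predU1P.
  - exact: (measurable_H [set h]).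
  - exact: (measurable_H [set h | h \in r]).
  - by apply/seteqP; split => w //= [->]; rewrite (negbTE hr).
rewrite /expect (eq_bigr (fun h => if b h then hypergraph_pmf h else 0)); last first.
  by move=> h _; case: (b h); rewrite ?mulr1 ?mulr0.
have := seqP (enum b) (enum_uniq _); rewrite big_enum/= -big_mkcond/= => <-.
by congr (P _); apply/seteqP; split => w /=; rewrite mem_enum.
Qed.

Lemma hypergraph_pmf_sum1 : \sum_h hypergraph_pmf h = 1.
Proof.
have := prob_hypergraph predT;
  have -> : [set w | predT (H w : {set V})] = setT by apply/seteqP; split.
rewrite probability_setT => -[->].
by apply: eq_bigr => h _; rewrite mulr1.
Qed.

Context (H_random : random_hypergraph P p H).

Lemma hypergraph_pmf_single h : hypergraph_pmf h != 0 ->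
  forall v, [set v]%SET \in h.
Proof.
move=> h0 v; have [H1 _ _] := H_random.
have /set0P[w <-] : [set w | (H w : {set V}) = h] != set0.
  by apply: contra_neq h0 => hE; rewrite /hypergraph_pmf hE measure0.
exact: H1.
Qed.

Lemma hypergraph_pmf_indep (J : {set V}) :
  J \subset [set s : V | (2 <= #|s|)%N]%SET ->
  expect hypergraph_pmf (fun h => (J \subset h)%:R) = \prod_(s in J) p #|s|.-1.
Proof.
move=> J2; have [_ Hp Hindep] := H_random.
apply: EFin_inj; rewrite -prob_hypergraph -prodEFin.
have -> : [set w | J \subset (H w : {set V})] =
    \bigcap_(s in [set` J]) [set w | s \in (H w : {set V})].
  apply/seteqP; split=> w /=; first by move=> /fintype.subsetP JH s; exact: JH.
  by move=> JH; apply/fintype.subsetP => s; exact: JH.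
rewrite Hindep//; apply: eq_bigr => s sJ.
have := fintype.subsetP J2 s sJ; rewrite inE => s2.
by apply: Hp; [case: #|s| s2 => [|[]]|rewrite prednK// (leq_trans _ s2)].
Qed.

End random_hypergraph_law.

(** * Elementary estimates and the final bound *)

Lemma leq_bin (n k : nat) : (0 < k < n)%N -> (n <= 'C(n, k))%N.
Proof.
elim: n k => [|n IH] [|k] //=; rewrite ltnS leq_eqVlt => /predU1P[->|kn].
  by rewrite binSn.
rewrite binS addnC; apply: (@leq_add 1 n); last exact: IH.
by rewrite bin_gt0 ltnW// ltnW.
Qed.

Lemma ln_ge1 {R : realType} (x : R) : 4 <= x -> 1 <= ln x.
Proof.
move=> x4; have x0 : 0 < x by lra.
rewrite -ler_expR lnK ?posrE//; apply: le_trans x4.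
have h : expR (2^-1) <= 2 :> R.
  rewrite -[leLHS]invrK -expRN invf_ple ?posrE ?expR_gt0//.
  by apply: le_trans (expR_ge1Dx _); lra.
have -> : 1 = 2^-1 + 2^-1 :> R by field.
by rewrite expRD; have := expR_gt0 (2^-1 : R); nra.
Qed.

Lemma hollow_prob_gt0 {R : realType} (p : nat -> R) (i : nat) :
  (forall j, (1 <= j < i)%N -> 0 < p j) -> 0 < hollow_prob p i.
Proof.
move=> p0; rewrite /hollow_prob big_nat_cond; apply: prodr_gt0 => j.
by rewrite andbT => /p0 pj0; exact: exprn_gt0.
Qed.

(** For i >= 2 the exponent (i + 6) / 2 is at least 4, and C(n, i+1) >= n >= 4 makes the logarithm
    at least 1. What remains is i^2 / (n (n - 1)) <= (i + 1)^2 / (n - i)^2. *)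
Lemma variance_term_le {R : realType} (n i : nat) (P : R) : (2 <= i)%N ->
  (i.+1 < n)%N -> 0 < P ->
  4 * ((i%:R * i.+1%:R) ^+ 2 / (2 * n%:R * (n%:R - 1) * P)) <=
  2 * (n%:R - i%:R) ^- 2 * P^-1 * (i%:R + 1) `^ ((i%:R + 6) / 2)
    * ln 'C(n, i.+1)%:R `^ 2^-1.
Proof.
move=> i2 i_n P0.
have n4 : (4 <= n)%N by rewrite (leq_trans _ i_n).
have ln1 : 1 <= ln 'C(n, i.+1)%:R :> R.
  by rewrite ln_ge1// (ler_nat R 4) (leq_trans n4)// leq_bin.
have i2R : 2 <= i%:R :> R by rewrite (ler_nat R 2).
have in2 : i%:R + 1 < n%:R :> R by rewrite natr1 ltr_nat.
set a : R := _ `^ ((_ + 6) / 2); set l := _ `^ 2^-1.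
have a4 : (i%:R + 1) ^+ 4 <= a.
  rewrite -powR_mulrn; last by lra.
  by apply: ler_powR; lra.
have l1 : 1 <= l.
  rewrite /l powR12_sqrt ?(le_trans ler01 ln1)//.
  by rewrite -[leLHS]sqrtr1 ler_sqrt ?(le_trans ler01 ln1).
apply: (@le_trans _ _ (2 * (n%:R - i%:R) ^- 2 * P^-1 * a)); last first.
  by rewrite ler_peMr// !mulr_ge0 ?invr_ge0 ?sqr_ge0 ?powR_ge0// ltW.
apply: (@le_trans _ _ (2 * (n%:R - i%:R) ^- 2 * P^-1 * (i%:R + 1) ^+ 4)); last first.
  by rewrite ler_wpM2l// !mulr_ge0 ?invr_ge0 ?sqr_ge0// ltW.
rewrite -[i.+1%:R]natr1; move: (i%:R : R) (n%:R : R) i2R in2 => x y x2 xy.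
have y0 : y != 0 by apply: lt0r_neq0; lra.
have y1 : y - 1 != 0 by apply: lt0r_neq0; lra.
have yx : y - x != 0 by apply: lt0r_neq0; lra.
have Pn := lt0r_neq0 P0.
have -> : 4 * ((x * (x + 1)) ^+ 2 / (2 * y * (y - 1) * P)) =
    2 * P^-1 * (x + 1) ^+ 2 * (x ^+ 2 / (y * (y - 1))).
  by field; rewrite ?y0 ?y1 ?yx ?Pn.
have -> : 2 * (y - x) ^- 2 * P^-1 * (x + 1) ^+ 4 =
    2 * P^-1 * (x + 1) ^+ 2 * ((x + 1) ^+ 2 / (y - x) ^+ 2).
  by field; rewrite ?y0 ?y1 ?yx ?Pn.
apply: ler_wpM2l.
  by rewrite mulr_ge0 ?sqr_ge0// mulr_ge0// invr_ge0 ltW.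
apply: ler_pM; first exact: sqr_ge0.
- by rewrite invr_ge0; nra.
- by nra.
- by rewrite lef_pV2 ?posrE; nra.
Qed.

Theorem theorem3p5 (R : realType) (n d i : nat) (p : nat -> R)
  (disp1 disp2 : measure_display)
  (T1 : measurableType disp1) (T2 : measurableType disp2)
  (P : probability T1 R) (Q : probability T2 R)
  (H : {RV P >-> hypergraph n}) (Z : {RV Q >-> R})
  (d_ge2 : (2 <= d)%N)
  (p_in01 : forall j : nat, (1 <= j <= d)%N -> 0 < p j < 1)
  (p_eq0 : forall j : nat, (d < j)%N -> p j = 0)
  (H_random : random_hypergraph P p H)
  (lnn_gt1 : 1 < ln (n%:R : R))
  (d_le : d%:R <= log2 (ln (n%:R : R)) + log2 (log2 (ln (n%:R : R)))
                  - log2 (- ln (min_prob p d)))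
  (i_bounds : (2 <= i <= d)%N)
  (i_ltn : (i < n)%N)
  (Z_normal : normal_law Q Z 0 (p i * (1 - p i))) :
  (KS_distance P Q (normalized_mle p i \o H) Z <=
     ((Num.sqrt 10 + 3) / (3 * Num.sqrt pi)
        * (p i * (1 - p i) * hollow_prob p i) `^ (- 2^-1)
        * 'C(n, i.+1)%:R `^ (- 2^-1)
      + 2 * (n%:R - i%:R) ^- 2 * (hollow_prob p i)^-1
        * (i%:R + 1) `^ ((i%:R + 6) / 2) * ln 'C(n, i.+1)%:R `^ 2^-1
      + 2 * 'C(n, i.+1)%:R ^- 2)%:E)%E.
Proof.
have /andP[i2 id] := i_bounds; have i1 : (1 <= i)%N := ltnW i2.
have pi01 : 0 < p i < 1 by apply: p_in01; rewrite i1.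
have /andP[pi_gt0 pi_lt1] := pi01.
have q_gt0 : 0 < 1 - p i by rewrite subr_gt0.
have v_gt0 : 0 < p i * (1 - p i) by rewrite mulr_gt0.
have hp_gt0 : 0 < hollow_prob p i.
  apply: hollow_prob_gt0 => j /andP[j1 ji].
  suff /andP[] : 0 < p j < 1 by [].
  by apply: p_in01; rewrite j1 (leq_trans (ltnW ji)).
have C_gt0 : 0 < 'C(n, i.+1)%:R :> R by rewrite ltr0n bin_gt0.
apply: ge_ereal_sup => _ [x _ <-].
set s := Num.sqrt (p i * (1 - p i)); have s_gt0 : 0 < s by rewrite sqrtr_gt0.
set Phi := fun y => fine (cdf Z (s * y)).
have Phi_cdf : std_normal_cdf Phi := normal_law_std_cdf v_gt0 Z_normal.
have -> : cdf Z x = (Phi (x / s))%:E.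
  by rewrite /Phi mulrC divfK ?gt_eqF// fineK// fin_num_measure.
pose pH := hypergraph_pmf H.
have -> : cdf (P := P) (normalized_mle p i \o H) x =
    (expect pH (fun h => (normalized_mle p i (h : hypergraph n) <= x)%R%:R))%:E.
  have setE : [set w | normalized_mle p i (H w) <= x]%classic =
      ((normalized_mle p i \o H) @^-1` `]-oo, x])%classic.
    by apply/seteqP; split => w /=; rewrite in_itv.
  by rewrite -(prob_hypergraph H (fun h => normalized_mle p i h <= x)) setE.
have pH0 := hypergraph_pmf_ge0 H; have pH1 := hypergraph_pmf_sum1 H.
have pH_indep := hypergraph_pmf_indep H_random.
have pH_single := hypergraph_pmf_single H_random.
rewrite -EFinB/= lee_fin.
set F := expect pH _; set b1 := _ * 'C(n, i.+1)%:R `^ (- 2^-1).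
have b1E : b1 = (Num.sqrt 10 + 3) / (3 * Num.sqrt pi) /
    Num.sqrt ('C(n, i.+1)%:R * hollow_prob p i * (p i * (1 - p i))).
  rewrite /b1 !powRN !powR12_sqrt ?mulr_ge0 ?(ltW hp_gt0) ?(ltW q_gt0) ?(ltW pi_gt0)//.
  rewrite -[_ / Num.sqrt (_ * hollow_prob p i) / _]mulrA -invfM -sqrtrM; last first.
    by rewrite !mulr_ge0// ltW.
  by congr (_ / Num.sqrt _); ring.
have b1_ge0 : 0 <= b1 by rewrite b1E !mulr_ge0 ?invr_ge0 ?mulr_ge0 ?addr_ge0.
have b2_ge0 : 0 <= 2 * (n%:R - i%:R) ^- 2 * (hollow_prob p i)^-1
    * (i%:R + 1) `^ ((i%:R + 6) / 2) * ln 'C(n, i.+1)%:R `^ 2^-1.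
  by rewrite !mulr_ge0 ?powR_ge0 ?invr_ge0 ?sqr_ge0 ?(ltW hp_gt0).
have b3_ge0 : 0 <= 2 * 'C(n, i.+1)%:R ^- 2 :> R.
  by rewrite mulr_ge0// invr_ge0 sqr_ge0.
have F_le1 : `|F - Phi (x / s)| <= 1.
  have := std_normal_cdf_ge0 Phi_cdf (x / s);
    have := std_normal_cdf_le1 Phi_cdf (x / s).
  have : 0 <= F by apply: sumr_ge0 => h _; rewrite mulr_ge0 ?pH0.
  have : F <= 1.
    rewrite -[1](expect_cst pH1); apply: expect_le => // h _.
    by case: (_ <= x)%R.
  by rewrite ler_norml; lra.
(* If n = i + 1 the binomial coefficient is 1 and the last term equals 2, above the trivial bound
   1. *)
have [n_small|n_big] := leqP n i.+1.
  have nE : n = i.+1 by apply/eqP; rewrite eqn_leq n_small.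
  have b3E : 2 * 'C(n, i.+1)%:R ^- 2 = 2 :> R.
    by rewrite nE binn expr1n invr1 mulr1.
  by apply: (le_trans F_le1); rewrite b3E; lra.
(* The quadratic comparison needs b <= 1; otherwise the first term already exceeds the trivial
   bound. *)
have [b1_le1|b1_gt1] := leP b1 1; last first.
  by apply: (le_trans F_le1); apply: (le_trans (ltW b1_gt1)); lra.
have close := @normalized_mle_cdf_close R n i p Phi Phi_cdf pH pH0 pH1 pH_indep
  pH_single i1 i_ltn pi01 hp_gt0 x.
rewrite -b1E in close.
apply: le_trans (close b1_le1) _.
have V := hollow_count_variance pH0 pH1 pH_indep i1 hp_gt0 i_ltn.
have V2 := variance_term_le i2 n_big hp_gt0.
rewrite -addrA lerD2l.
apply: (@le_trans _ _ (2 * (n%:R - i%:R) ^- 2 * (hollow_prob p i)^-1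
    * (i%:R + 1) `^ ((i%:R + 6) / 2) * ln 'C(n, i.+1)%:R `^ 2^-1)).
  by apply: le_trans V2; rewrite ler_pM2l.
by rewrite lerDl.
Qed.
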